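(* Let $n\ge2$ and, for $\alpha\ge0$, let the production and investment costs be $C^P(q,\alpha\theta)$ and $C^I(q,\alpha\theta)$. There exists $\overline\alpha>0$ such that for all $0\le\alpha<\overline\alpha$ the optimal symmetric mechanism is not an optimal mechanism (i.e. it does not solve problem (P): some mechanism with an equilibrium feasible in (P) gives the buyer a strictly higher expected utility).
   Context: Setting. A buyer procures one contract from $n$ firms. Firm $i$ has a private type $\theta_i\in[0,1]$; types are i.i.d. with cdf $F$ and strictly positive density $f$. $V:\mathbb R_+\to\mathbb R$ is the buyer's value of quality. For given $\alpha$ write $c^P(q,\theta)=C^P(q,\alpha\theta)$ (production, winner-pay cost) and $c^I(q,\theta)=C^I(q,\alpha\theta)$ (investment, all-pay cost), both nonnegative; all functions are as smooth as needed. Firm $i$'s payoff is $t_i-c^P(q_i,\theta_i)z_i-c^I(q_i,\theta_i)$; the buyer's payoff is $\sum_i(V(q_i)z_i-t_i)$ ($z_i$ share of the contract, $t_i$ transfer to firm $i$). Virtual costs: $\tilde c^P=c^P+c^P_\theta F/f$, $\tilde c^I=c^I+c^I_\theta F/f$. Standing assumptions (for each small $\alpha>0$; for $\alpha=0$ those not involving $\theta$-derivatives). For $q>0$, $\theta\in(0,1)$: $c^P_q,c^P_\theta,c^I_q,c^I_\theta,c^P_{q\theta},c^I_{q\theta}>0$; $c^I(0,\theta)=c^I_q(0,\theta)=0$; $V'\ge0$, $V''\le0$; $\tilde c^P_\theta>0$, $\tilde c^P_{qq}>0$, $\tilde c^P_{q\theta}\ge0$, $\tilde c^I_\theta>0$,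 $\tilde c^I_{qq}>0$, $\tilde c^I_{q\theta}\ge0$. For every $\theta\in[0,1]$: $V'(0)>\tilde c^P_q(0,\theta)$, and $V'(q)<\tilde c^P_q(q,\theta)+\tilde c^I_q(q,\theta)$ for all large $q$. Mechanisms and problem (P). A mechanism $\mathcal M$ consists of message sets $M_i$ and functions $z_i(\mathbf m,\mathbf q)$, $t_i(\mathbf m,\mathbf q)$. After the announcement of $\mathcal M$, each firm learns its type, then chooses $q_i\ge0$ and $m_i\in M_i$; a strategy is $\sigma_i(\theta_i)=(m_i(\theta_i),q_i(\theta_i))$. Problem (P): maximize the buyer's expected utility over $(\mathcal M,\bm\sigma)$ such that $\bm\sigma$ is a Bayes--Nash equilibrium of $\mathcal M$ (almost every type's choice maximizes interim expected payoff over all $(m_i',q_i'')\in M_i\times\mathbb R_+$), interim expected equilibrium payoffs are $\ge0$, and on the equilibrium path $z_i\ge0$, $\sum_iz_i=1$. The optimal symmetric mechanism is the solution of (P) under the restriction that the induced quality functions $q_i(\theta_i)$ and allocation functions $z_i(\bm\theta)$ are invariant under permutations of the firms' indices. It induces the allocation $z_i(\bm\theta)=\mathbb I[\theta_i=\min_j\theta_j]$, the common quality function $q^*_{sym}$ where for $\theta<1$, $q=q^*_{sym}(\theta)$ solves $V'(q)=\tilde c^P_q(q,\theta)+\tilde c^I_q(q,\theta)/(1-F(\theta))^{n-1}$, and it yields the buyer $\mathbb E\sum_{i}\big((V(q_i)-\tilde c^P(q_i,\theta_i))z_i-\tilde c^I(q_i,\theta_i)\big)$ evaluated at these functions. *)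

(* Defs.v *)
(* MathComp-Analysis; the reals are an arbitrary R : realType. *)
From HB Require Import structures.
From mathcomp Require Import all_boot all_order all_algebra all_fingroup.
From mathcomp Require Import all_classical all_reals all_analysis.

Set Implicit Arguments.
Unset Strict Implicit.
Unset Printing Implicit Defensive.

Import Order.TTheory GRing.Theory Num.Theory.
Import numFieldNormedType.Exports.

Local Open Scope classical_set_scope.
Local Open Scope ring_scope.

(* Derivative of f at x relative to D: the difference quotient only visits
   points of D, so it is one-sided at an endpoint of an interval D and never
   looks at the values of f outside D. *)
Definition derivable_in (R : realType) (D : set R) (f : R -> R) (x : R) : Prop :=
  cvg ((f y - f x) / (y - x) @[y --> within D x^']).

Definition derive_in (R : realType) (D : set R) (f : R -> R) (x : R) : R :=
  lim ((f y - f x) / (y - x) @[y --> within D x^']).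

Definition partial1 (R : realType) (D : set R) (g : R -> R -> R) : R -> R -> R :=
  fun x y => derive_in D (g^~ y) x.

Definition partial2 (R : realType) (D : set R) (g : R -> R -> R) : R -> R -> R :=
  fun x y => derive_in D (g x) y.

Fixpoint Ck_on (R : realType) (D : set R) (k : nat) (f : R -> R) : Prop :=
  {within D, continuous f} /\
  (if k is j.+1 then
     (forall x : R, D x -> derivable_in D f x) /\ Ck_on D j (derive_in D f)
   else True).

Definition half_line (R : realType) : set R := `[0, +oo[.
Definition unit_itv (R : realType) : set R := `[0, 1].

Fixpoint Ck_quadrant (R : realType) (k : nat) (g : R -> R -> R) : Prop :=
  let H := @half_line R in
  {within H `*` H, continuous (fun p : R * R => g p.1 p.2)} /\
  (if k is j.+1 then
     [/\ forall x y : R, H x -> H y -> derivable_in H (g^~ y) x,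
         forall x y : R, H x -> H y -> derivable_in H (g x) y,
         Ck_quadrant j (partial1 H g) & Ck_quadrant j (partial2 H g)]
   else True).

(* The four primitives V, C^P, C^I and f.  V is used on [0, +oo[, the costs on
   [0, +oo[ ^ 2 and the type density on [0, 1]; other values are irrelevant. *)
Record environment (R : realType) := Environment {
  V : R -> R;
  CP : R -> R -> R;
  CI : R -> R -> R;
  dens : R -> R }.

Definition dV (R : realType) (E : environment R) : R -> R :=
  derive_in (@half_line R) (V E).

Definition cP (R : realType) (E : environment R) (a : R) : R -> R -> R :=
  fun q theta => CP E q (a * theta).

Definition cI (R : realType) (E : environment R) (a : R) : R -> R -> R :=
  fun q theta => CI E q (a * theta).

Definition dq (R : realType) (g : R -> R -> R) : R -> R -> R :=
  partial1 (@half_line R) g.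

Definition dtheta (R : realType) (g : R -> R -> R) : R -> R -> R :=
  partial2 (@unit_itv R) g.

Definition type_cdf (R : realType) (E : environment R) (x : R) : R :=
  \int[@lebesgue_measure R]_(t in `[0, x]) dens E t.

Definition virtual (R : realType) (E : environment R) (c : R -> R -> R) :
    R -> R -> R :=
  fun q theta => c q theta + dtheta c q theta * (type_cdf E theta / dens E theta).

(* The orders of differentiability are the ones needed for every derivative
   in the assumptions below (e.g. virtual costs differentiated twice) to make
   sense. *)
Definition smooth_environment (R : realType) (E : environment R) : Prop :=
  [/\ Ck_on (@half_line R) 2 (V E), Ck_quadrant 3 (CP E),
      Ck_quadrant 3 (CI E) & Ck_on (@unit_itv R) 1 (dens E)].

Definition value_assumptions (R : realType) (E : environment R) : Prop :=
  forall q : R, 0 < q ->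
    0 <= dV E q /\ derive_in (@half_line R) (dV E) q <= 0.

(* The assumptions without theta-derivatives; for a = 0 the virtual costs are
   the costs themselves, since these do not depend on theta. *)
Record level_assumptions (R : realType) (E : environment R) (a : R) : Prop := {
  cP_ge0 : forall (q theta : R), 0 <= q -> 0 <= theta <= 1 -> 0 <= cP E a q theta;
  cI_ge0 : forall (q theta : R), 0 <= q -> 0 <= theta <= 1 -> 0 <= cI E a q theta;
  cP_q_gt0 : forall (q theta : R), 0 < q -> 0 < theta < 1 -> 0 < dq (cP E a) q theta;
  cI_q_gt0 : forall (q theta : R), 0 < q -> 0 < theta < 1 -> 0 < dq (cI E a) q theta;
  cI_at0 : forall theta : R, 0 < theta < 1 -> cI E a 0 theta = 0;
  cI_q_at0 : forall theta : R, 0 < theta < 1 -> dq (cI E a) 0 theta = 0;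
  vcP_qq_gt0 : forall (q theta : R), 0 < q -> 0 < theta < 1 ->
    0 < dq (dq (virtual E (cP E a))) q theta;
  vcI_qq_gt0 : forall (q theta : R), 0 < q -> 0 < theta < 1 ->
    0 < dq (dq (virtual E (cI E a))) q theta;
  marginal_value_at0 : forall theta : R, 0 <= theta <= 1 ->
    dq (virtual E (cP E a)) 0 theta < dV E 0;
  marginal_value_at_infty : forall theta : R, 0 <= theta <= 1 ->
    \forall q \near +oo,
      dV E q < dq (virtual E (cP E a)) q theta + dq (virtual E (cI E a)) q theta }.

Record type_assumptions (R : realType) (E : environment R) (a : R) : Prop := {
  cP_theta_gt0 : forall (q theta : R), 0 < q -> 0 < theta < 1 ->
    0 < dtheta (cP E a) q theta;
  cI_theta_gt0 : forall (q theta : R), 0 < q -> 0 < theta < 1 ->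
    0 < dtheta (cI E a) q theta;
  cP_qtheta_gt0 : forall (q theta : R), 0 < q -> 0 < theta < 1 ->
    0 < dtheta (dq (cP E a)) q theta;
  cI_qtheta_gt0 : forall (q theta : R), 0 < q -> 0 < theta < 1 ->
    0 < dtheta (dq (cI E a)) q theta;
  vcP_theta_gt0 : forall (q theta : R), 0 < q -> 0 < theta < 1 ->
    0 < dtheta (virtual E (cP E a)) q theta;
  vcI_theta_gt0 : forall (q theta : R), 0 < q -> 0 < theta < 1 ->
    0 < dtheta (virtual E (cI E a)) q theta;
  vcP_qtheta_ge0 : forall (q theta : R), 0 < q -> 0 < theta < 1 ->
    0 <= dtheta (dq (virtual E (cP E a))) q theta;
  vcI_qtheta_ge0 : forall (q theta : R), 0 < q -> 0 < theta < 1 ->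
    0 <= dtheta (dq (virtual E (cI E a))) q theta }.

Definition standing_assumptions (R : realType) (E : environment R) : Prop :=
  [/\ smooth_environment E,
      value_assumptions E,
      level_assumptions E 0 &
      \forall a \near (0 : R)^'+, level_assumptions E a /\ type_assumptions E a].

(* P is the joint law of the type profile: the n-fold product of the law on
   [0, 1] with density (dens E). *)
Definition iid_types (R : realType) (n : nat) (E : environment R)
    (P : probability (n.-tuple R) R) : Prop :=
  (forall x : R, 0 <= x <= 1 -> 0 < dens E x) /\
  forall A : 'I_n -> set R, (forall i, measurable (A i)) ->
    P [set th | forall i, A i (tnth th i)] =
    (\prod_(i < n)
       \int[@lebesgue_measure R]_(x in A i `&` `[0, 1]) dens E x)%:E.

Record mechanism (R : realType) (n : nat) := Mechanism {
  msg : 'I_n -> Type;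
  alloc : 'I_n -> (forall j, msg j) -> ('I_n -> R) -> R;
  transfer : 'I_n -> (forall j, msg j) -> ('I_n -> R) -> R }.

Record strategy (R : realType) (n : nat) (M : mechanism R n) := Strategy {
  message : forall i, R -> msg M i;
  quality : 'I_n -> R -> R }.

Definition messages (R : realType) (n : nat) (M : mechanism R n)
    (s : strategy M) (th : n.-tuple R) : forall j, msg M j :=
  fun j => message s j (tnth th j).

Definition qualities (R : realType) (n : nat) (M : mechanism R n)
    (s : strategy M) (th : n.-tuple R) : 'I_n -> R :=
  fun j => quality s j (tnth th j).

Definition induced_alloc (R : realType) (n : nat) (M : mechanism R n)
    (s : strategy M) (i : 'I_n) (th : n.-tuple R) : R :=
  alloc i (messages s th) (qualities s th).

Definition induced_transfer (R : realType) (n : nat) (M : mechanism R n)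
    (s : strategy M) (i : 'I_n) (th : n.-tuple R) : R :=
  transfer i (messages s th) (qualities s th).

(* Outcomes when firm i chooses (m, q) and the others follow s; they depend on
   th only through the types of the other firms. *)
Definition choice_alloc (R : realType) (n : nat) (M : mechanism R n)
    (s : strategy M) (i : 'I_n) (m : msg M i) (q : R) (th : n.-tuple R) : R :=
  alloc i (dfwith (messages s th) i m) (dfwith (qualities s th) i q).

Definition choice_transfer (R : realType) (n : nat) (M : mechanism R n)
    (s : strategy M) (i : 'I_n) (m : msg M i) (q : R) (th : n.-tuple R) : R :=
  transfer i (dfwith (messages s th) i m) (dfwith (qualities s th) i q).

(* Types being independent, the expectation over th of a function of the other
   firms' types is the expectation conditional on firm i's own type. *)
Definition interim_payoff (R : realType) (n : nat) (E : environment R) (a : R)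
    (P : probability (n.-tuple R) R) (M : mechanism R n) (s : strategy M)
    (i : 'I_n) (theta : R) (m : msg M i) (q : R) : R :=
  (\int[P]_th
     (choice_transfer s m q th - cP E a q theta * choice_alloc s m q th))
  - cI E a q theta.

Definition buyer_utility (R : realType) (n : nat) (E : environment R)
    (P : probability (n.-tuple R) R) (M : mechanism R n) (s : strategy M) : R :=
  \int[P]_th \sum_(i < n)
    (V E (qualities s th i) * induced_alloc s i th - induced_transfer s i th).

(* Qualities are nonnegative and all expected payoffs exist. *)
Record well_posed (R : realType) (n : nat) (E : environment R)
    (P : probability (n.-tuple R) R) (M : mechanism R n) (s : strategy M)
    : Prop := {
  wp_quality_ge0 : forall i (x : R), 0 <= x <= 1 -> 0 <= quality s i x;
  wp_quality : forall i, measurable_fun setT (quality s i);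
  wp_alloc : forall i, measurable_fun setT (induced_alloc s i);
  wp_value : forall i, P.-integrable setT
    (fun th => (V E (qualities s th i) * induced_alloc s i th)%:E);
  wp_transfer : forall i, P.-integrable setT
    (fun th => (induced_transfer s i th)%:E);
  wp_choice_alloc : forall i (m : msg M i) (q : R), 0 <= q ->
    P.-integrable setT (fun th => (choice_alloc s m q th)%:E);
  wp_choice_transfer : forall i (m : msg M i) (q : R), 0 <= q ->
    P.-integrable setT (fun th => (choice_transfer s m q th)%:E) }.

(* The density of types is positive, so "almost every type" refers to Lebesgue
   measure on [0, 1]. *)
Definition for_almost_every_type (R : realType) (Q : R -> Prop) : Prop :=
  {ae @lebesgue_measure R, forall x : R, 0 <= x <= 1 -> Q x}.

Definition bayes_nash (R : realType) (n : nat) (E : environment R) (a : R)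
    (P : probability (n.-tuple R) R) (M : mechanism R n) (s : strategy M)
    : Prop :=
  forall i, for_almost_every_type (fun x =>
    forall (m : msg M i) (q : R), 0 <= q ->
      interim_payoff E a P s x m q <=
      interim_payoff E a P s x (message s i x) (quality s i x)).

Definition individually_rational (R : realType) (n : nat) (E : environment R)
    (a : R) (P : probability (n.-tuple R) R) (M : mechanism R n)
    (s : strategy M) : Prop :=
  forall i, for_almost_every_type (fun x =>
    0 <= interim_payoff E a P s x (message s i x) (quality s i x)).

Definition allocates_contract (R : realType) (n : nat)
    (P : probability (n.-tuple R) R) (M : mechanism R n) (s : strategy M)
    : Prop :=
  {ae P, forall th, (forall i, 0 <= induced_alloc s i th) /\
                    \sum_(i < n) induced_alloc s i th = 1}.

Definition feasible (R : realType) (n : nat) (E : environment R) (a : R)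
    (P : probability (n.-tuple R) R) (M : mechanism R n) (s : strategy M)
    : Prop :=
  [/\ well_posed E P s, bayes_nash E a P s, individually_rational E a P s &
      allocates_contract P s].

(* Firm i in the permuted profile has the type of firm (p i) in th. *)
Definition symmetric_mechanism (R : realType) (n : nat)
    (P : probability (n.-tuple R) R) (M : mechanism R n) (s : strategy M)
    : Prop :=
  forall p : 'S_n,
    (forall i, for_almost_every_type (fun x => quality s (p i) x = quality s i x))
    /\ {ae P, forall th, forall i,
         induced_alloc s (p i) th =
         induced_alloc s i [tuple tnth th (p j) | j < n]}.

Definition optimal_symmetric_mechanism (R : realType) (n : nat) (E : environment R)
    (a : R) (P : probability (n.-tuple R) R) (M : mechanism R n)
    (s : strategy M) : Prop :=
  [/\ feasible E a P s, symmetric_mechanism P s &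
      forall (M' : mechanism R n) (s' : strategy M'),
        feasible E a P s' -> symmetric_mechanism P s' ->
        buyer_utility E P s' <= buyer_utility E P s].

Definition optimal_mechanism (R : realType) (n : nat) (E : environment R)
    (a : R) (P : probability (n.-tuple R) R) (M : mechanism R n)
    (s : strategy M) : Prop :=
  feasible E a P s /\
  forall (M' : mechanism R n) (s' : strategy M'),
    feasible E a P s' -> buyer_utility E P s' <= buyer_utility E P s.

(* The quality function induced by the optimal symmetric mechanism; it is pinned
   down on [0, 1[ only. *)
Definition is_q_sym (R : realType) (n : nat) (E : environment R) (a : R)
    (q : R -> R) : Prop :=
  measurable_fun (`[0%R, 1%R[ : set R) q /\
  forall theta : R, 0 <= theta < 1 ->
    0 <= q theta /\
    dV E (q theta) =
      dq (virtual E (cP E a)) (q theta) theta +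
      dq (virtual E (cI E a)) (q theta) theta
        / (1 - type_cdf E theta) ^+ n.-1.

Definition lowest_type_wins (R : realType) (n : nat) (i : 'I_n)
    (th : n.-tuple R) : R :=
  [forall j, tnth th i <= tnth th j]%:R.

(* Virtual surplus, in the extended reals since integrability is not assumed.
   The profiles with a type outside [0, 1[ have probability 0. *)
Definition symmetric_value (R : realType) (n : nat) (E : environment R)
    (a : R) (P : probability (n.-tuple R) R) (q : R -> R) : \bar R :=
  (\int[P]_(th in [set th : n.-tuple R | forall i, 0 <= tnth th i < 1]%R)
   (\sum_(i < n)
     ((V E (q (tnth th i)) - virtual E (cP E a) (q (tnth th i)) (tnth th i))
        * lowest_type_wins i th
      - virtual E (cI E a) (q (tnth th i)) (tnth th i)))%:E)%E.

(* Main.v *)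
From HB Require Import structures.
Require Import Defs.
From mathcomp Require Import all_boot all_order all_algebra all_fingroup.
From mathcomp Require Import all_classical all_reals all_analysis.
From mathcomp Require Import measurable_realfun ring lra.
Set Implicit Arguments.
Unset Strict Implicit.
Import Order.TTheory GRing.Theory Num.Theory.
Import numFieldNormedType.Exports.
Local Open Scope ring_scope.

(* At level 0 a single firm investing in the quality c that maximizes
   V - C^P(., 0) - C^I(., 0) earns the buyer the maximal surplus S, and for
   small a it still earns S - eps once the transfer also covers the cost of the
   worst type. In a symmetric mechanism all firms use one quality function q.
   Compare q with a small threshold eta and let A be the set of types with
   q <= eta. If all types lie in A, the winner forgoes at least gamma of
   surplus; if none does, each of the n - 1 losers wastes an investment of at
   least gamma. One of the two events has probability at least 2^-n, so the
   buyer gets at most S - gamma 2^-n, uniformly in a, because costs and virtual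
   costs at level a dominate the costs at level 0. The bound uses individual
   rationality only: integrated over the firm's own type, it bounds the expected
   transfers from below by the expected costs. *)

(** * Independent types *)

Definition box (T : Type) (n : nat) (A : 'I_n -> set T) : set (n.-tuple T) :=
  [set th | forall i, A i (tnth th i)]%classic.

(** Resamples the opponents of firm [i]: with independent draws in both components the profile has
    law [P] again ([mix_preserves]). Firm [i]'s type can thus be fixed while the opponents are still
    described by a full profile, as in [interim_payoff]. *)
Definition mix (T : Type) (n : nat) (i : 'I_n)
    (z : n.-tuple T * n.-tuple T) : n.-tuple T :=
  [tuple if j == i then tnth z.1 j else tnth z.2 j | j < n].

Section Product.
Local Open Scope classical_set_scope.
Context (R : realType) (n : nat) (P : probability (n.-tuple R) R).
Variable law : set R -> R.
Hypothesis law_ge0 : forall A, 0 <= law A.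
Hypothesis indep : forall A : 'I_n -> set R, (forall i, measurable (A i)) ->
  P (box A) = (\prod_(i < n) law (A i))%:E.

Lemma measurable_box (A : 'I_n -> set R) :
  (forall i, measurable (A i)) -> measurable (box A).
Proof.
move=> mA; rewrite (_ : box A = \bigcap_(i in [set: 'I_n])
    ((fun th : n.-tuple R => tnth th i) @^-1` A i)).
  apply: fin_bigcap_measurable => // i _.
  by rewrite -[X in measurable X]setTI; exact: measurable_tnth.
by apply/seteqP; split=> th /= h i; [move=> _; exact: h | exact: h].
Qed.

(** The whole space is a box, so the n-th power of the left side is 1; the index [i] excludes n =
    0. *)
Lemma law_setT (i : 'I_n) : law setT = 1.
Proof.
have := indep (fun _ => measurableT); rewrite prodr_const card_ord.
rewrite (_ : box _ = setT); last by apply/seteqP; split.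
rewrite probability_setT => -[] /esym /eqP.
by rewrite pexpr_eq1 ?law_ge0 // => [/eqP //|]; case: n i => [[]|].
Qed.

Lemma prob_coord (i : 'I_n) (A : set R) : measurable A ->
  P [set th | A (tnth th i)] = (law A)%:E.
Proof.
move=> mA; have := @indep (fun j => if j == i then A else setT).
rewrite (_ : box _ = [set th | A (tnth th i)]); last first.
  apply/seteqP; split=> th /=; first by move=> /(_ i); rewrite eqxx.
  by move=> h j; case: eqVneq => // ->.
move=> ->; last by move=> j; case: ifP.
rewrite (bigD1 i) //= eqxx big1 ?mulr1 // => j /negPf ->.
exact: law_setT i.
Qed.

Lemma measurable_mix (i : 'I_n) : measurable_fun setT (@mix R n i).
Proof.
apply/measurable_fun_tnthP => j.
rewrite (_ : _ \o _ = if j == i then (@tnth n R ^~ j) \o fst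
                      else (@tnth n R ^~ j) \o snd); last first.
  by apply/funext => z /=; rewrite tnth_mktuple; case: ifP.
by case: ifP => _; apply: measurableT_comp => //; exact: measurable_tnth.
Qed.

(** Cylinders generate the tuple sigma-algebra and are boxes; boxes are moreover closed under
    intersection, as uniqueness of measures requires. *)
Lemma measurable_tuple_box :
  measurable = <<s [set B : set (n.-tuple R) | exists A : 'I_n -> set R,
    (forall i, measurable (A i)) /\ B = box A] >>.
Proof.
apply/seteqP; split.
  apply: smallest_sub; first exact: smallest_sigma_algebra.
  rewrite -bigcup_seq => B /= [i _ [A mA <-]].
  apply: sub_sigma_algebra; exists (fun j => if j == i then A else setT).
  split; first by move=> j; case: ifP.
  apply/seteqP; split=> th /=.
    by move=> [_ h] j; case: eqVneq => // ->.
  by move=> /(_ i); rewrite eqxx.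
apply: smallest_sub; first exact: sigma_algebra_measurable.
by move=> B [A [mA ->]]; exact: measurable_box.
Qed.

(** Uniqueness of measures on the pi-system of boxes. The preimage of a box is the product of a
    cylinder in coordinate [i] and a box free in that coordinate, so both measures factor in the
    same way. *)
Lemma mix_preserves (i : 'I_n) (B : set (n.-tuple R)) : measurable B ->
  P B = pushforward (P \x P)%E (mix i) B.
Proof.
pose m := measurable_mix i.
pose f : {mfun (n.-tuple R * n.-tuple R)%type >-> n.-tuple R} :=
  HB.pack (mix i) (isMeasurableFun.Build _ _ _ _ _ m).
apply: (measure_unique [set B : set (n.-tuple R) | exists A : 'I_n -> set R,
    (forall i, measurable (A i)) /\ B = box A] (fun _ => setT) _ _ _ _
    P (pushforward (P \x P)%E f)).
- exact: measurable_tuple_box.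
- move=> _ _ [A [mA ->]] [A' [mA' ->]]; exists (fun j => A j `&` A' j).
  split; first by move=> j; exact: measurableI.
  apply/seteqP; split=> th /=; first by move=> [h h'] j; split; [exact: h|exact: h'].
  by move=> h; split=> j; have [] := h j.
- by move=> _; exists (fun _ => setT); split=> //; apply/seteqP; split.
- by rewrite bigcup_const //; exists 0%N.
- move=> _ [A [mA ->]].
  change (P (box A) = (P \x P)%E (mix i @^-1` box A)).
  rewrite (_ : _ @^-1` _ =
    [set th | A i (tnth th i)] `*` box (fun j => if j == i then setT else A j)).
    rewrite product_measure1E //; last 2 first.
    - by rewrite -[X in measurable X]setTI; exact: measurable_tnth.
    - by apply: measurable_box => j; case: ifP.
    pose A' := fun j => if j == i then setT else A j.
    have mA' j : measurable (A' j) by rewrite /A'; case: ifP.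
    transitivity ((law (A i))%:E * (\prod_(j < n) law (A' j))%:E)%E.
      rewrite indep // -EFinM; congr EFin.
      rewrite (bigD1 i) //= [in RHS](bigD1 i) //= /A' eqxx (law_setT i) mul1r.
      by congr (_ * _); apply: eq_bigr => j /negPf ->.
    by congr (_ * _)%E; [exact/esym/prob_coord | exact/esym/indep].
  apply/seteqP; split=> -[x y] /=.
    move=> h; split; first by have := h i; rewrite tnth_mktuple eqxx.
    by move=> j; have := h j; rewrite tnth_mktuple; case: eqP.
  move=> [h1 h2] j; rewrite tnth_mktuple /=; case: eqVneq => [->//|ji].
  by have := h2 j; rewrite (negPf ji).
- by move=> _; exact: le_lt_trans (probability_le1 _ _) (ltry _).
Qed.

Lemma integral_mix (i : 'I_n) (h : n.-tuple R -> \bar R) :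
  P.-integrable setT h ->
  (P \x P)%E.-integrable setT (h \o mix i) /\
  (\int[P]_th h th = \int[P]_x \int[P]_y h (mix i (x, y)))%E.
Proof.
move=> ih.
have mh := measurable_int _ ih.
pose m := measurable_mix i.
pose f : {mfun (n.-tuple R * n.-tuple R)%type >-> n.-tuple R} :=
  HB.pack (mix i) (isMeasurableFun.Build _ _ _ _ _ m).
have E (g : n.-tuple R -> \bar R) : (\int[P]_th g th =
    \int[pushforward (P \x P) f]_th g th)%E.
  by apply: eq_measure_integral => A mA _; exact: mix_preserves.
have ihm : (P \x P)%E.-integrable setT (h \o mix i).
  apply/integrableP; split; first exact: measurableT_comp mh m.
  move/integrableP : ih => [_]; rewrite E.
  rewrite (@ge0_integral_pushforward _ _ _ _ R f m (P \x P)%E setT) //.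
  exact: measurableT_comp.
split=> //; rewrite E (@integral_pushforward _ _ _ _ R f m (P \x P)%E) //.
by rewrite preimage_setT -integral12_prod_meas1.
Qed.

(** The inner integral is the conditional expectation given firm [i]'s type, so interim inequalities
    become ex ante ones. *)
Lemma integral_ge0_of_sections (i : 'I_n) (h : n.-tuple R -> R) :
  P.-integrable setT (EFin \o h) ->
  {ae P, forall x, 0 <= \int[P]_y h (mix i (x, y))} ->
  0 <= \int[P]_th h th.
Proof.
move=> ih hge.
have [ihm E] := integral_mix i ih.
rewrite /Rintegral E; apply: fine_ge0.
have mF := measurable_fubini_F ihm.
(* Almost every section integral equals its positive part; exchanging the two makes the outer
   integrand nonnegative everywhere. *)
have hge' : {ae P, forall x, setT x ->
    (\int[P]_y (h (mix i (x, y)))%:E = (fubini_F P (EFin \o h \o mix i))^\+ x)%E}.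
  apply: filterS2 hge (ae_integrable1 ihm) => x /= + iy _.
  rewrite funeposE => h0.
  rewrite /fubini_F; symmetry; apply/max_idPl.
  by move: h0; rewrite /Rintegral -lee_fin fineK //; exact: integrable_fin_num.
rewrite (_ : (\int[P]_x _ = \int[P]_x (fubini_F P ((EFin \o h) \o mix i))^\+ x)%E).
  by apply: integral_ge0.
apply: ae_eq_integral hge' => //; exact: measurable_funepos.
Qed.

(** Fix the type of [i] and resample the others: the type of [j] then has to hit a single point, a
    null event. *)
Lemma ties_negligible (i j : 'I_n) :
  (forall x : R, law [set x] = 0) -> j != i ->
  P.-negligible [set th | tnth th i = tnth th j].
Proof.
move=> law1 ji.
set D := [set th | _].
have mD : measurable D.
  have -> : D = (fun th : n.-tuple R => tnth th i - tnth th j) @^-1` [set 0].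
    by apply/seteqP; split=> th /= => [->|/eqP]; [rewrite subrr | rewrite subr_eq0 => /eqP].
  rewrite -[X in measurable X]setTI; apply: measurable_funB => //; exact: measurable_tnth.
apply/negligibleP => //.
transitivity (pushforward (P \x P)%E (mix i) D); first exact: mix_preserves.
rewrite /pushforward /product_measure1.
rewrite integral0_eq // => x _ /=.
rewrite (_ : xsection _ _ = [set th | [set tnth x i] (tnth th j)]).
  by rewrite (prob_coord j) // law1.
apply/seteqP; split=> y; rewrite /xsection /= ?inE /D /= !tnth_mktuple eqxx (negPf ji) //.
Qed.

End Product.

(** * Bound on the penalized surplus *)

Section AlmostEverywhere.
Local Open Scope classical_set_scope.
Context d (T : measurableType d) (R : realType) (P : probability T R).
Implicit Types (f g h : T -> R).

Lemma Rintegral_probability_cst (r : R) : \int[P]_x r = r.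
Proof.
rewrite Rintegral_cst // [X in _ * X](_ : _ = 1) ?mulr1 //.
exact: (congr1 fine (probability_setT P)).
Qed.

(** Passing to the positive part does not change the integral; an infinite value becomes 0 under
    [fine], so the sign is safe either way. *)
Lemma ae_Rintegral_ge0 h : measurable_fun setT h ->
  {ae P, forall x, 0 <= h x} -> 0 <= \int[P]_x h x.
Proof.
move=> mh h0; rewrite /Rintegral; apply: fine_ge0.
have mEh : measurable_fun setT (EFin \o h) by exact/measurable_EFinP.
rewrite (_ : (\int[P]_x (h x)%:E = \int[P]_x ((EFin \o h)^\+ x))%E).
  by apply: integral_ge0.
apply: ae_eq_integral => //; first exact: measurable_funepos.
by apply: filterS h0 => x h0 _; rewrite funeposE; symmetry; apply/max_idPl; rewrite lee_fin.
Qed.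

Lemma ae_le_Rintegral f g : P.-integrable setT (EFin \o f) ->
  P.-integrable setT (EFin \o g) -> {ae P, forall x, f x <= g x} ->
  \int[P]_x f x <= \int[P]_x g x.
Proof.
move=> intf intg fg; rewrite -subr_ge0 -RintegralB //.
apply: ae_Rintegral_ge0; last by apply: filterS fg => x; rewrite subr_ge0.
by apply: measurable_funB; apply/measurable_EFinP; [exact: measurable_int intg|exact: measurable_int intf].
Qed.

Lemma ae_bounded_integrable h (M : R) : measurable_fun setT h -> 0 <= M ->
  {ae P, forall x, `|h x| <= M} -> P.-integrable setT (EFin \o h).
Proof.
move=> mh M0 hM; apply/integrableP; split; first exact/measurable_EFinP.
apply: (@le_lt_trans _ _ (\int[P]_x M%:E)%E).
  apply: ae_ge0_le_integral => //.
  - by apply/measurable_EFinP; apply: measurableT_comp.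
  - by apply: filterS hM => x hx _; rewrite lee_fin.
rewrite integral_cst // [X in (_ * X)%E](_ : _ = 1%E) ?mule1 ?ltry //.
exact: probability_setT.
Qed.

Lemma Rintegral_ord_sum n (f : 'I_n -> T -> R) :
  (forall i, P.-integrable setT (EFin \o f i)) ->
  \int[P]_x (\sum_(i < n) f i x) = \sum_(i < n) \int[P]_x f i x.
Proof.
move=> intf; rewrite /Rintegral.
under eq_integral do rewrite -sumEFin.
rewrite integral_sum // sum_fine // => i _.
by apply: integrable_fin_num; [exact: measurableT | exact: intf].
Qed.

Lemma integrable_ord_sum n (f : 'I_n -> T -> R) :
  (forall i, P.-integrable setT (EFin \o f i)) ->
  P.-integrable setT (EFin \o (fun x => \sum_(i < n) f i x)).
Proof.
move=> intf; rewrite (_ : EFin \o _ = (fun x => \sum_(i < n) (f i x)%:E)%E); last first.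
  by apply/funext => x /=; rewrite sumEFin.
by apply: integrable_sum => // i _; exact: intf.
Qed.

End AlmostEverywhere.

Section TypeLaw.
Local Open Scope classical_set_scope.
Context (R : realType) (n : nat) (E : environment R) (P : probability (n.-tuple R) R).
Hypothesis types : iid_types E P.
Hypothesis dens_cont : {within @unit_itv R, continuous (dens E)}.

Definition type_law (A : set R) : R :=
  \int[@lebesgue_measure R]_(x in A `&` `[0, 1]) dens E x.

Lemma type_law_ge0 A : 0 <= type_law A.
Proof.
apply: Rintegral_ge0 => x [_]; rewrite /= in_itv /= => x01.
by apply: ltW; exact: types.1.
Qed.

Lemma type_law_indep (A : 'I_n -> set R) : (forall i, measurable (A i)) ->
  P (box A) = (\prod_(i < n) type_law (A i))%:E.
Proof. exact: types.2. Qed.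

Lemma type_law_null (A : set R) : measurable A ->
  @lebesgue_measure R (A `&` @unit_itv R) = 0%E -> type_law A = 0.
Proof.
move=> mA A0; rewrite /type_law /Rintegral null_set_integral //.
  exact: measurableI.
apply/measurable_EFinP.
have m01 : measurable_fun (@unit_itv R) (dens E).
  by apply: subspace_continuous_measurable_fun => //; exact: measurable_itv.
by apply: measurable_funS m01; [exact: measurable_itv|move=> x []].
Qed.

Lemma type_law_set1 x : type_law [set x] = 0.
Proof.
apply: type_law_null => //.
have m01 : measurable (@unit_itv R) by exact: measurable_itv.
apply: (@subset_measure0 _ _ _ (@lebesgue_measure R) _ [set x]) => //.
- exact: measurableI.
- exact: lebesgue_measure_set1.
Qed.

Lemma ae_type (Q : R -> Prop) (i : 'I_n) : for_almost_every_type Q ->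
  {ae P, forall th, 0 <= tnth th i <= 1 /\ Q (tnth th i)}.
Proof.
move=> [N [mN N0 QN]].
(* Adding the complement of [0, 1], which [type_law] does not charge, also yields the range of the
   type. *)
pose N' := N `|` ~` `[(0:R), 1].
have mN' : measurable N' by apply: measurableU => //; exact: measurableC.
exists [set th | N' (tnth th i)]; split.
- by rewrite -[X in measurable X]setTI; exact: measurable_tnth.
- rewrite (prob_coord type_law_ge0 type_law_indep) // type_law_null //.
  have m01 : measurable (@unit_itv R) by exact: measurable_itv.
  apply: (@subset_measure0 _ _ _ (@lebesgue_measure R) _ N) => //; first exact: measurableI.
  by move=> x [[//|] h1 h2].
- move=> th /= h; apply: contrapT => hN; apply: h.
  have h01 : 0 <= tnth th i <= 1.
    apply: contrapT => h; apply: hN; right => /=; by rewrite in_itv.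
  split=> //; apply: contrapT => hQ; apply: hN; left; apply: QN => /= h.
  exact: hQ (h h01).
Qed.

End TypeLaw.

Section Core.
Local Open Scope classical_set_scope.
Context (R : realType) (n : nat) (P : probability (n.-tuple R) R).
Variable law : set R -> R.
Hypothesis law_ge0 : forall A, 0 <= law A.
Hypothesis indep : forall A : 'I_n -> set R, (forall i, measurable (A i)) ->
  P (box A) = (\prod_(i < n) law (A i))%:E.
Hypothesis n2 : (2 <= n)%N.

(** With [A] the set of low-quality types and [z] the share won: a low type loses in proportion to
    what it wins, a high type in proportion to what it fails to win. *)
Definition loss (A : set R) (x z : R) : R :=
  \1_A x * z + (1 - \1_A x) * (1 - z).

Lemma loss_in (A : set R) x z : A x -> loss A x z = z.
Proof. by move=> Ax; rewrite /loss indicE mem_set //= subrr mul0r addr0 mul1r. Qed.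

Lemma loss_out (A : set R) x z : ~ A x -> loss A x z = 1 - z.
Proof. by move=> Ax; rewrite /loss indicE memNset //= mul0r add0r subr0 mul1r. Qed.

Lemma loss_ge0 (A : set R) x z : 0 <= z <= 1 -> 0 <= loss A x z <= 1.
Proof.
move=> /andP[z0 z1]; have [Ax|Ax] := pselect (A x).
  by rewrite loss_in // z0.
by rewrite loss_out // subr_ge0 z1 lerBlDr lerDl.
Qed.

(** If all types lie in [A], the losses add up to the total share 1; if none does, they add up to n
    - 1, which is at least 1. In mixed profiles nonnegativity suffices. *)
Lemma sum_loss_ge (A : set R) (th : n.-tuple R) (z : 'I_n -> R) :
  (forall i, 0 <= z i) -> \sum_(i < n) z i = 1 ->
  \1_(box (fun _ => A)) th + \1_(box (fun _ => ~` A)) th <=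
  \sum_(i < n) loss A (tnth th i) (z i).
Proof.
move=> z0 z1.
have z01 i : 0 <= z i <= 1.
  by rewrite z0 /= -z1 (bigD1 i) //= lerDl sumr_ge0.
pose i0 : 'I_n := Ordinal (ltnW n2).
have [h1|h1] := pselect (box (fun=> A) th).
  have h2 : ~ box (fun=> ~` A) th by move=> /(_ i0); exact.
  rewrite !indicE mem_set //= memNset //= addr0 -z1.
  by apply: ler_sum => i _; rewrite loss_in.
have [h2|h2] := pselect (box (fun=> ~` A) th); last first.
  rewrite !indicE !memNset //= addr0; apply: sumr_ge0 => i _.
  by case/andP: (loss_ge0 A (tnth th i) (z01 i)).
rewrite !indicE memNset //= mem_set //= add0r.
rewrite (eq_bigr (fun i => 1 - z i)); last by move=> i _; rewrite loss_out //; exact: h2.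
rewrite sumrB z1 sumr_const card_ord lerBrDr.
by rewrite (_ : 1%:R + 1 = 2%:R) ?ler_nat.
Qed.

(** The two masses add up to 1, so one of them is at least 1/2. *)
Lemma law_split (A : set R) : measurable A ->
  (2^-1) ^+ n <= law A ^+ n + law (~` A) ^+ n.
Proof.
move=> mA; pose i0 : 'I_n := Ordinal (ltnW n2).
have : (law (~` A))%:E = (1 - (law A)%:E)%E.
  rewrite -(prob_coord law_ge0 indep i0 mA).
  rewrite -(prob_coord law_ge0 indep i0 (measurableC mA)).
  rewrite -probability_setC; last by rewrite -[X in measurable X]setTI; exact: measurable_tnth.
  by congr (P _).
rewrite -EFinB => -[E].
have h0 := law_ge0 A; have h1 := law_ge0 (~` A).
have [h|h] := leP 2^-1 (law A).
  apply: (@le_trans _ _ (law A ^+ n)); last by rewrite lerDl exprn_ge0.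
  by rewrite lerXn2r // nnegrE ?invr_ge0.
apply: (@le_trans _ _ (law (~` A) ^+ n)); last by rewrite lerDr exprn_ge0.
rewrite lerXn2r // ?nnegrE ?invr_ge0 // E; lra.
Qed.

Section Bound.
Variables (z : 'I_n -> n.-tuple R -> R) (A : set R) (S gamma : R).
Hypothesis mz : forall i, measurable_fun setT (z i).
Hypothesis zae : {ae P, forall th, (forall i, 0 <= z i th) /\ \sum_(i < n) z i th = 1}.
Hypothesis mA : measurable A.
Hypothesis gamma0 : 0 <= gamma.

(** Common majorant for firm [i]'s contribution to the surplus, both in an arbitrary symmetric
    mechanism and in the formula for the symmetric value ([surplus_penalized]). *)
Definition penalized (i : 'I_n) (th : n.-tuple R) : R :=
  S * z i th - gamma * loss A (tnth th i) (z i th).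

Lemma alloc_ae01 i : {ae P, forall th, 0 <= z i th <= 1}.
Proof.
apply: filterS zae => th [z0 z1].
by rewrite z0 /= -z1 (bigD1 i) //= lerDl sumr_ge0.
Qed.

Lemma measurable_loss i : measurable_fun setT (fun th : n.-tuple R => loss A (tnth th i) (z i th)).
Proof.
have m1 : measurable_fun setT (fun th : n.-tuple R => \1_A (tnth th i) : R).
  have mI : measurable_fun [set: R] (\1_A : R -> R) by exact: measurable_indic.
  exact: (measurableT_comp mI (measurable_tnth i)).
apply: measurable_funD; apply: measurable_funM => //; apply: measurable_funB => //.
Qed.

Lemma integrable_penalized i : P.-integrable setT (EFin \o penalized i).
Proof.
have iz : P.-integrable setT (EFin \o z i).
  apply: (@ae_bounded_integrable _ _ _ _ _ 1) => //.
  by apply: filterS (alloc_ae01 i) => th /andP[z0 z1]; rewrite ger0_norm.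
have il : P.-integrable setT (EFin \o (fun th : n.-tuple R => loss A (tnth th i) (z i th))).
  apply: (@ae_bounded_integrable _ _ _ _ _ 1) => //; first exact: measurable_loss.
  apply: filterS (alloc_ae01 i) => th /(loss_ge0 A (tnth th i)) /andP[l0 l1].
  by rewrite ger0_norm.
have := integrableB measurableT (integrableZl measurableT S iz) (integrableZl measurableT gamma il).
exact.
Qed.

(** Shares add up to 1, so the first terms integrate to [S]; the expected loss is at least the sum
    of two box probabilities, hence at least 2^-n by [law_split]. *)
Lemma penalized_bound :
  \int[P]_th (\sum_(i < n) penalized i th) <= S - gamma * 2^-1 ^+ n.
Proof.
have mB1 : measurable (box (fun _ : 'I_n => A)) by exact: measurable_box.
have mB2 : measurable (box (fun _ : 'I_n => ~` A)).
  by apply: measurable_box => _; exact: measurableC.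
pose g (th : n.-tuple R) : R := \1_(box (fun _ : 'I_n => A)) th + \1_(box (fun _ => ~` A)) th.
have i1 : P.-integrable setT (EFin \o (\1_(box (fun _ : 'I_n => A)) : _ -> R)).
  exact: integrable_indic.
have i2 : P.-integrable setT (EFin \o (\1_(box (fun _ : 'I_n => ~` A)) : _ -> R)).
  exact: integrable_indic.
have ig : P.-integrable setT (EFin \o g) by exact: (integrableD measurableT i1 i2).
have iS : P.-integrable setT (EFin \o (fun _ : n.-tuple R => S)).
  exact: finite_measure_integrable_cst.
have igg : P.-integrable setT (EFin \o (fun th => gamma * g th)).
  exact: (integrableZl measurableT gamma ig).
apply: (@le_trans _ _ (\int[P]_th (S - gamma * g th))).
  apply: ae_le_Rintegral.
  - by apply: integrable_ord_sum => i; exact: integrable_penalized.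
  - exact: (integrableB measurableT iS igg).
  - apply: filterS zae => th [z0 z1].
    rewrite /penalized sumrB -!mulr_sumr z1 mulr1 lerD2l lerN2.
    by rewrite ler_wpM2l //; exact: sum_loss_ge.
rewrite RintegralB // Rintegral_probability_cst lerD2l lerN2.
rewrite RintegralZl // ler_wpM2l // RintegralD //.
rewrite /Rintegral !integral_indic // !setIT.
have E1 : fine (P (box (fun _ : 'I_n => A))) = law A ^+ n.
  by rewrite indep //= prodr_const card_ord.
have E2 : fine (P (box (fun _ : 'I_n => ~` A))) = law (~` A) ^+ n.
  by rewrite indep /= ?prodr_const ?card_ord // => _; exact: measurableC.
by have := law_split mA; rewrite -E1 -E2.
Qed.

End Bound.
End Core.

(** * Derivatives relative to a set *)

Section DerivIn.
Local Open Scope classical_set_scope.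
Context (R : realType).
Implicit Types (D : set R) (f g : R -> R) (x l : R).

(** Carries existence and value of the derivative together; [derive_in] alone takes the default
    value 0 where there is no limit. *)
Definition has_deriv_in D f x l : Prop :=
  (f y - f x) / (y - x) @[y --> within D x^'] --> l.

Lemma derivable_in_has_deriv D f x :
  derivable_in D f x -> has_deriv_in D f x (derive_in D f x).
Proof. by []. Qed.

(** A divergent quotient has the default limit 0, so a nonzero [derive_in] is a true derivative.
    Strict sign assumptions on derivatives thereby entail differentiability. *)
Lemma derive_in_neq0_has_deriv D f x :
  derive_in D f x != 0 -> has_deriv_in D f x (derive_in D f x).
Proof.
move=> h; apply: derivable_in_has_deriv; apply: contrapT => /dvgP E.
by move: h; rewrite /derive_in E eqxx.
Qed.

Lemma has_deriv_inB D f g x l m :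
  has_deriv_in D f x l -> has_deriv_in D g x m ->
  has_deriv_in D (fun y => f y - g y) x (l - m).
Proof.
move=> hf hg; rewrite /has_deriv_in.
rewrite (_ : (fun y => _) = (fun y => (f y - f x) / (y - x) - (g y - g x) / (y - x))).
  exact: cvgB.
by apply/funext => y; rewrite -mulrBl; congr (_ / _); ring.
Qed.

Lemma within_dnbhs_interior D x : nbhs x D -> within D x^' = x^'.
Proof.
move=> Dx; apply/seteqP; split=> A.
  change (nbhs x (fun y => y != x -> D y -> A y) -> nbhs x (fun y => y != x -> A y)).
  by move: Dx; apply: filterS2 => y Dy h yx; exact: h.
change (nbhs x (fun y => y != x -> A y) -> nbhs x (fun y => y != x -> D y -> A y)).
by apply: filterS => y h yx _; exact: h.
Qed.

(** At interior points the relative derivative is the two-sided one, which the mean value theorem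
    takes as input. *)
Lemma has_deriv_in_is_derive D f x l :
  nbhs x D -> has_deriv_in D f x l -> is_derive x 1 f l.
Proof.
move=> Dx; rewrite /has_deriv_in within_dnbhs_interior // => h.
have h2 : (fun h : R => h^-1 *: ((f \o shift x) (h *: (1 : R)) - f x)) @ 0^' --> l.
  rewrite (_ : (fun h => _) = (fun y => (f y - f x) / (y - x)) \o shift x).
    apply: (@cvg_comp _ _ _ (shift x) _ _ x^' _ _ h).
    have c : shift x y @[y --> nbhs (0 : R)] --> x.
      rewrite -[X in _ --> X]add0r; apply: cvgD; [exact: cvg_id|exact: cvg_cst].
    move=> A; change (nbhs x (fun y => y != x -> A y) ->
      nbhs (0 : R) (fun y => y != 0 -> A (y + x))) => /c.
    apply: (@filterS _ (nbhs (0 : R))) => y; rewrite /shift /= => {}h y0; apply: h.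
    by rewrite -subr_eq0 addrK.
  apply/funext => y /=; rewrite /shift /= addrK scaler1 [_ *: _]mulrC.
  by [].
have dl : 'D_1 f x = l by exact: cvg_lim h2.
by rewrite -dl; apply: derivableP; apply/cvg_ex; exists l.
Qed.

Lemma has_deriv_in_gt0_lt D f df (a b : R) : a < b -> `[a, b] `<=` D ->
  {within `[a, b], continuous f} ->
  (forall x, a < x < b -> has_deriv_in D f x (df x) /\ 0 < df x) -> f a < f b.
Proof.
move=> ab abD cf h.
have [|c cab E] := @MVT R f df a b ab _ cf.
  move=> x; rewrite in_itv /= => xab; apply: has_deriv_in_is_derive (h x xab).1.
  near=> y; apply: abD; rewrite /= in_itv /=; apply/andP; split; apply: ltW; near: y.
    by apply: lt_nbhsr; case/andP: xab.
  by apply: lt_nbhsl; case/andP: xab.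
move: cab; rewrite in_itv /= => /h [_ dc].
by rewrite -subr_gt0 E mulr_gt0 ?subr_gt0.
Unshelve. all: by end_near.
Qed.

(** An interval to the right of [x] keeps the punctured filter nontrivial, so limits along it are
    unique. *)
Lemma within_dnbhs_proper_right D x b : x < b -> `[x, b] `<=` D ->
  ProperFilter (within D x^').
Proof.
move=> xb xbD; apply: Build_ProperFilter_ex => A.
change (nbhs x (fun y => y != x -> D y -> A y) -> exists y, A y) => h.
have h2 : \forall y \near x^'+, A y.
  change (\forall y \near x, x < y -> A y).
  near=> y => xy; have : y != x -> D y -> A y by near: y.
  apply; first by rewrite gt_eqF.
  apply: xbD; rewrite /= in_itv /= (ltW xy) /= ltW //; near: y; exact: lt_nbhsl.
exact: (@filter_ex _ x^'+ _ A h2).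
Unshelve. all: by end_near.
Qed.

Lemma within_dnbhs_proper_left D a x : a < x -> `[a, x] `<=` D ->
  ProperFilter (within D x^').
Proof.
move=> ax axD; apply: Build_ProperFilter_ex => A.
change (nbhs x (fun y => y != x -> D y -> A y) -> exists y, A y) => h.
have h2 : \forall y \near x^'-, A y.
  change (\forall y \near x, y < x -> A y).
  near=> y => yx; have : y != x -> D y -> A y by near: y.
  apply; first by rewrite lt_eqF.
  apply: axD; rewrite /= in_itv /= (ltW yx) andbT ltW //; near: y; exact: lt_nbhsr.
exact: (@filter_ex _ x^'- _ A h2).
Unshelve. all: by end_near.
Qed.

Lemma unit_itv_proper x : 0 <= x <= 1 -> ProperFilter (within (@unit_itv R) x^').
Proof.
move=> /andP[x0 x1]; have [x1'|x1'] := ltP x 1.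
  apply: (@within_dnbhs_proper_right _ _ 1) => // y; rewrite /unit_itv /= !in_itv /=.
  by move=> /andP[xy ->]; rewrite andbT (le_trans x0).
apply: (@within_dnbhs_proper_left _ 0); first exact: lt_le_trans x1'.
by move=> y; rewrite /unit_itv /= !in_itv /= => /andP[-> yx]; rewrite (le_trans yx).
Qed.

Lemma half_line_proper x : 0 <= x -> ProperFilter (within (@half_line R) x^').
Proof.
move=> x0; apply: (@within_dnbhs_proper_right _ _ (x + 1)); first by rewrite ltrDl.
by move=> y; rewrite /half_line /= !in_itv /= andbT => /andP[xy _]; exact: le_trans xy.
Qed.

Lemma derive_in_cst D x (c : R) : ProperFilter (within D x^') ->
  derive_in D (fun=> c) x = 0.
Proof.
move=> PF; rewrite /derive_in.
rewrite (_ : (fun y => _) = (fun=> 0)); last by apply/funext => y; rewrite subrr mul0r.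
exact: lim_cst.
Qed.

(* If the difference quotient has no limit, [lim] is the junk value 0. *)
Lemma derive_in_ge0 D f x : ProperFilter (within D x^') -> D x ->
  (forall y z, D y -> D z -> y <= z -> f y <= f z) -> 0 <= derive_in D f x.
Proof.
move=> PF Dx ndf; have [->//|/derive_in_neq0_has_deriv] := eqVneq (derive_in D f x) 0.
move=> h; apply: (cvgr_to_ge h).
change (x^' (fun y => D y -> 0 <= (f y - f x) / (y - x))).
near=> y => Dy.
have [xy|yx] := leP x y.
  by rewrite divr_ge0 ?subr_ge0 //; exact: ndf.
by rewrite -mulrNN -invrN !opprB divr_ge0 ?subr_ge0 ?(ltW yx) //; apply: ndf => //; exact: ltW.
Unshelve. all: by end_near.
Qed.

Lemma has_deriv_in_gt0_ex f l : has_deriv_in (@half_line R) f 0 l -> 0 < l ->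
  exists2 y, 0 < y & f 0 < f y.
Proof.
move=> h l0; have PF := half_line_proper (lexx (0 : R)).
have /filter_ex [y [[Hy yn0]]] : \forall y \near within (@half_line R) 0^',
    (half_line y /\ y != 0) /\ 0 < (f y - f 0) / (y - 0).
  apply: filterI; last exact: cvgr_gt h _ l0.
  by apply: (@nearW _ (nbhs (0 : R))).
rewrite subr0; have y0 : 0 < y.
  by move: Hy; rewrite /half_line /= in_itv /= andbT lt_neqAle eq_sym yn0.
by rewrite pmulr_lgt0 ?invr_gt0 // subr_gt0; exists y.
Unshelve. all: by end_near.
Qed.

Lemma Ck_on_half_line_derivable k f x : Ck_on (@half_line R) k.+1 f -> 0 <= x ->
  has_deriv_in (@half_line R) f x (derive_in (@half_line R) f x).
Proof.
by move=> [_ [h _]] x0; apply: derivable_in_has_deriv; apply: h; rewrite /half_line /= in_itv /= x0.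
Qed.

Lemma Ck_quadrant_comp k (g : R -> R -> R) D (p : R -> R * R) :
  Ck_quadrant k g -> continuous p ->
  (forall x, D x -> 0 <= (p x).1 /\ 0 <= (p x).2) ->
  {within D, continuous (fun x => g (p x).1 (p x).2)}.
Proof.
move=> Cg cp hp.
have {Cg} : {within (@half_line R) `*` (@half_line R),
  continuous (fun z : R * R => g z.1 z.2)} by case: k Cg => [|k] [].
move=> /subspace_continuousP Cg.
have HP x : D x -> ((@half_line R) `*` (@half_line R)) (p x).
  by move=> /hp [h1 h2]; split; rewrite /half_line /= in_itv /= andbT.
apply/subspace_continuousP => x Dx.
apply: (cvg_comp _ _ _ (Cg _ (HP _ Dx))).
move=> A hA; change (nbhs x (fun y => D y -> A (p y))).
by have := cp x _ hA; apply: (@filterS _ (nbhs x)) => y h Dy; exact: h (HP _ Dy).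
Qed.

End DerivIn.

(** * Costs and surplus *)

Section Costs.
Local Open Scope classical_set_scope.
Context (R : realType).
Implicit Types (C : R -> R -> R) (a q theta : R).

Lemma Ck_quadrant_continuous_theta k C (a q : R) : Ck_quadrant k C -> 0 <= a ->
  0 <= q -> {within `[0, 1], continuous (fun theta => C q (a * theta))}.
Proof.
move=> hC a0 q0; apply: (@Ck_quadrant_comp _ _ _ _ (fun theta => (q, a * theta)) hC).
  move=> x; apply: (@cvg_pair _ _ _ (nbhs x) (nbhs q) (nbhs (a * x)) _ _ _ (fun=> q)).
    exact: cvg_cst.
  by apply: cvgM; [exact: cvg_cst | exact: cvg_id].
by move=> x; rewrite /= in_itv /= => /andP[x0 _]; split=> //; exact: mulr_ge0.
Qed.

Lemma Ck_quadrant_continuous_q k C (y : R) : Ck_quadrant k C -> 0 <= y ->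
  {within @half_line R, continuous (fun q => C q y)}.
Proof.
move=> hC y0; apply: (@Ck_quadrant_comp _ _ _ _ (fun q => (q, y)) hC).
  move=> x; apply: (@cvg_pair _ _ _ (nbhs x) (nbhs x) (nbhs y) _ _ _ id).
    exact: cvg_id.
  exact: cvg_cst.
by move=> x; rewrite /half_line /= in_itv /= andbT.
Qed.

Lemma half_line_cvg_right (f : R -> R) : {within @half_line R, continuous f} ->
  f x @[x --> 0^'+] --> f 0.
Proof.
move=> /subspace_continuousP /(_ 0) h.
have H0 : half_line (0 : R) by rewrite /half_line /= in_itv /= lexx.
apply: cvg_trans (h H0); apply: cvg_app => A.
change (nbhs (0 : R) (fun y => half_line y -> A y) -> nbhs (0 : R) (fun y => 0 < y -> A y)).
by apply: filterS => y hA y0; apply: hA; rewrite /half_line /= in_itv /= andbT ltW.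
Qed.

(** At [a = 0] the cost is constant in the type. Otherwise the mean value theorem applies for
    positive quality; quality 0, about which the sign assumption is silent, follows by letting the
    quality tend to 0 from the right. *)
Lemma cost_nondecreasing_theta k C a (hC : Ck_quadrant k C) (a0 : 0 <= a)
  (hmono : a = 0 \/ forall q theta : R, 0 < q -> 0 < theta < 1 ->
     0 < dtheta (fun q t => C q (a * t)) q theta) (q x y : R) :
  0 <= q -> 0 <= x -> x <= y -> y <= 1 -> C q (a * x) <= C q (a * y).
Proof.
move=> q0 x0 xy y1; case: hmono => [->|hmono]; first by rewrite !mul0r.
have [<-//|xy'] := eqVneq x y.
have {xy'}xy' : x < y by rewrite lt_neqAle xy' xy.
have pos p : 0 < p -> C p (a * x) < C p (a * y).
  move=> p0; have cC := Ck_quadrant_continuous_theta hC a0 (ltW p0).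
  have sub : `[x, y] `<=` `[(0 : R), 1].
    move=> z /=; rewrite !in_itv /= => /andP[xz zy].
    by rewrite (le_trans x0 xz) (le_trans zy y1).
  apply: (@has_deriv_in_gt0_lt _ (@unit_itv R) (fun t => C p (a * t))
    (dtheta (fun q t => C q (a * t)) p) _ _ xy' sub).
    exact: continuous_subspaceW sub cC.
  move=> z /andP[xz zy].
  have h : 0 < dtheta (fun q t => C q (a * t)) p z.
    by apply: hmono => //; rewrite (le_lt_trans x0 xz) (lt_le_trans zy y1).
  by split=> //; apply: derive_in_neq0_has_deriv; rewrite gt_eqF.
have [<-|q0'] := eqVneq 0 q; last by apply: ltW; apply: pos; rewrite lt_neqAle q0'.
have y0 := le_trans x0 xy.
apply: ler_cvg_to (half_line_cvg_right (Ck_quadrant_continuous_q hC (mulr_ge0 a0 x0)))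
  (half_line_cvg_right (Ck_quadrant_continuous_q hC (mulr_ge0 a0 y0))) _.
by near=> p; apply: ltW; apply: pos; near: p; exact: nbhs_right_gt.
Unshelve. all: by end_near.
Qed.

End Costs.

Section TypeCdf.
Local Open Scope classical_set_scope.
Context (R : realType) (E : environment R).
Hypothesis dens_gt0 : forall x : R, 0 <= x <= 1 -> 0 < dens E x.

Lemma type_cdf_ge0 x : 0 <= x <= 1 -> 0 <= type_cdf E x.
Proof.
move=> /andP[x0 x1]; apply: Rintegral_ge0 => t /=; rewrite in_itv /= => /andP[t0 tx].
by apply: ltW; apply: dens_gt0; rewrite t0 (le_trans tx).
Qed.

(** The cost dominates that of type 0, which is the cost at level 0. The correction term is
    nonnegative: it is F/f times the [derive_in] of a nondecreasing function. *)
Lemma virtual_cost_lb k (C : R -> R -> R) (a : R) : Ck_quadrant k C -> 0 <= a ->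
  a = 0 \/ (forall q theta : R, 0 < q -> 0 < theta < 1 ->
     0 < dtheta (fun q t => C q (a * t)) q theta) ->
  forall q theta, 0 <= q -> 0 <= theta <= 1 ->
  C q 0 <= virtual E (fun q t => C q (a * t)) q theta.
Proof.
move=> hC a0 hmono q x q0 /[dup] x01 /andP[x0 x1].
have := cost_nondecreasing_theta hC a0 hmono q0 (lexx 0) x0 x1; rewrite mulr0.
move=> /le_trans; apply; rewrite lerDl mulr_ge0 //; last first.
  by rewrite divr_ge0 ?type_cdf_ge0 // ltW // dens_gt0.
have PF := unit_itv_proper x01.
apply: derive_in_ge0; first by rewrite /unit_itv /= in_itv /= x01.
move=> y z; rewrite /unit_itv /= !in_itv /= => /andP[y0 _] /andP[_ z1] yz.
exact: cost_nondecreasing_theta hC a0 hmono _ _ _ q0 y0 yz z1.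
Qed.

End TypeCdf.

Section Level0.
Local Open Scope classical_set_scope.
Context (R : realType) (E : environment R).
Hypothesis smooth : smooth_environment E.
Hypothesis lvl0 : level_assumptions E 0.

Let H := @half_line R.
Let u (q : R) := V E q - CP E q 0.
Let kk (q : R) := CI E q 0.

(** At level 0 all types have the same costs, so type 1/2 can represent them in every assumption
    stated for interior types. *)
Lemma half_in_itv01 : 0 < (2^-1 : R) < 1.
Proof. by rewrite invr_gt0 ltr0n invf_lt1 ?ltr1n ?ltr0n. Qed.

Lemma cost_level0 (C : R -> R -> R) : (fun q theta => C q (0 * theta)) = (fun q (_ : R) => C q 0).
Proof. by apply/funext => q; apply/funext => x; rewrite mul0r. Qed.

(** The cost at level 0 is constant in the type, so the information rent vanishes. *)
Lemma dq_virtual0 (C : R -> R -> R) (q : R) :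
  dq (virtual E (fun q theta => C q (0 * theta))) q 2^-1 = derive_in H (C^~ 0) q.
Proof.
rewrite /dq /partial1; congr derive_in; apply/funext => p.
have PF : ProperFilter (within (@unit_itv R) (2^-1 : R)^').
  by apply: unit_itv_proper; have /andP[/ltW -> /ltW ->] := half_in_itv01.
by rewrite cost_level0 /virtual /dtheta /partial2 derive_in_cst mul0r addr0.
Qed.

Lemma Ck_quadrant_has_deriv_q k (C : R -> R -> R) (q : R) : Ck_quadrant k.+1 C ->
  0 <= q -> has_deriv_in H (C^~ 0) q (derive_in H (C^~ 0) q).
Proof.
move=> [_ [h _ _ _]] q0; apply: derivable_in_has_deriv; apply: h.
  by rewrite /half_line /= in_itv /= q0.
by rewrite /half_line /= in_itv /= lexx.
Qed.

Lemma surplus_has_deriv (q : R) : 0 <= q ->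
  has_deriv_in H (fun q => u q - kk q) q
    (dV E q - derive_in H ((CP E)^~ 0) q - derive_in H ((CI E)^~ 0) q).
Proof.
move=> q0; case: smooth => sV sP sI _.
apply: has_deriv_inB; last exact: Ck_quadrant_has_deriv_q sI q0.
by apply: has_deriv_inB; [exact: Ck_on_half_line_derivable sV q0|exact: Ck_quadrant_has_deriv_q sP q0].
Qed.

Lemma within_continuousB (D : set R) (f g : R -> R) :
  {within D, continuous f} -> {within D, continuous g} ->
  {within D, continuous (fun x => f x - g x)}.
Proof.
move=> /subspace_continuousP cf /subspace_continuousP cg.
apply/subspace_continuousP => x Dx; apply: cvgB; [exact: cf|exact: cg].
Qed.

Lemma surplus_continuous : {within H, continuous (fun q => u q - kk q)}.
Proof.
case: smooth => -[sV _] sP sI _.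
apply: within_continuousB; last exact: Ck_quadrant_continuous_q sI (lexx 0).
by apply: within_continuousB => //; exact: Ck_quadrant_continuous_q sP (lexx 0).
Qed.

Lemma itv_sub_half_line (a b : R) : 0 <= a -> `[a, b] `<=` H.
Proof.
by move=> a0 x; rewrite /H /half_line /= !in_itv /= andbT => /andP[ax _]; exact: le_trans ax.
Qed.

Lemma invest_cost_at0 : kk 0 = 0.
Proof. by have := cI_at0 lvl0 half_in_itv01; rewrite /cI mul0r. Qed.

Lemma invest_cost_lt (x y : R) : 0 <= x -> x < y -> kk x < kk y.
Proof.
move=> x0 xy; case: smooth => _ _ sI _.
apply: (@has_deriv_in_gt0_lt _ H _ (derive_in H ((CI E)^~ 0)) _ _ xy (itv_sub_half_line x0)).
  exact: continuous_subspaceW (itv_sub_half_line x0) (Ck_quadrant_continuous_q sI (lexx 0)).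
move=> z /andP[xz zy]; split.
  by apply: Ck_quadrant_has_deriv_q sI _; exact: le_trans (ltW xz).
have := cI_q_gt0 lvl0 (le_lt_trans x0 xz) half_in_itv01.
by rewrite /cI /dq /partial1 mul0r.
Qed.

Lemma surplus_decreasing_infty : exists2 Q : R, 0 < Q &
  forall q, Q < q -> u q - kk q < u Q - kk Q.
Proof.
have h01 : 0 <= (2^-1 : R) <= 1 by have /andP[/ltW -> /ltW ->] := half_in_itv01.
have [M [Mr hM]] := marginal_value_at_infty lvl0 h01.
pose Q := Num.max M 0 + 1; have Q0 : 0 < Q by rewrite ltr_wpDl // le_max lexx orbT.
exists Q => // q Qq; case: smooth => -[sV _] sP sI _.
(* The surplus is negated because [has_deriv_in_gt0_lt] concerns increasing functions. *)
suff : kk Q - u Q < kk q - u q by lra.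
apply: (@has_deriv_in_gt0_lt _ H (fun q => kk q - u q) (fun q =>
  derive_in H ((CI E)^~ 0) q - (dV E q - derive_in H ((CP E)^~ 0) q))
  _ _ Qq (itv_sub_half_line (ltW Q0))).
  apply: continuous_subspaceW (itv_sub_half_line (ltW Q0)) _.
  apply: within_continuousB; first exact: Ck_quadrant_continuous_q sI (lexx 0).
  by apply: within_continuousB => //; exact: Ck_quadrant_continuous_q sP (lexx 0).
move=> z /andP[Qz _]; have z0 := ltW (lt_trans Q0 Qz); split.
  case: smooth => {}sV _ _ _.
  apply: has_deriv_inB; first exact: Ck_quadrant_has_deriv_q sI z0.
  apply: has_deriv_inB; last exact: Ck_quadrant_has_deriv_q sP z0.
  exact: Ck_on_half_line_derivable sV z0.
have /hM : M < z.
  by apply: le_lt_trans Qz; rewrite /Q (le_trans (_ : M <= Num.max M 0)) ?le_max ?lexx // lerDl.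
rewrite !dq_virtual0; lra.
Qed.

(** Compactness of [0, Q]; beyond Q the surplus stays below its value at Q. *)
Lemma surplus_attains_max : exists2 c : R, 0 <= c &
  forall q, 0 <= q -> u q - kk q <= u c - kk c.
Proof.
have [Q Q0 hQ] := surplus_decreasing_infty.
have [c] := EVT_max (ltW Q0) (continuous_subspaceW (itv_sub_half_line (b:=Q) (lexx 0)) surplus_continuous).
rewrite in_itv /= => /andP[c0 cQ] hc; exists c => // q q0.
have [qQ|Qq] := leP q Q; first by apply: hc; rewrite in_itv /= q0.
apply: (le_trans (ltW (hQ _ Qq))); apply: hc.
by rewrite in_itv /= lexx (ltW Q0).
Qed.

(** The marginal investment cost vanishes at 0, so the right derivative of the surplus there is
    V'(0) minus the marginal production cost, which is positive. *)
Lemma surplus_gt_at0 : exists2 y : R, 0 < y & u 0 - kk 0 < u y - kk y.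
Proof.
apply: has_deriv_in_gt0_ex (surplus_has_deriv (lexx 0)) _.
have := cI_q_at0 lvl0 half_in_itv01; rewrite /dq /partial1 /cI mul0r => d0.
rewrite d0 subr0 subr_gt0 -dq_virtual0; apply: (marginal_value_at0 lvl0).
by have /andP[/ltW -> /ltW ->] := half_in_itv01.
Qed.

(** Quality 0 is not a maximizer, so by continuity qualities up to some [eta] miss the maximum by a
    fixed amount; above [eta] the investment cost is bounded away from 0. *)
Lemma surplus_gap : exists c eta gamma : R,
  [/\ 0 <= c, 0 < gamma, forall q, 0 <= q -> u q - kk q <= u c - kk c,
      forall q, 0 <= q <= eta -> u q - kk q <= u c - kk c - gamma &
      forall q, 0 <= q -> 0 <= kk q /\ (eta < q -> gamma <= kk q)].
Proof.
have [c c0 hc] := surplus_attains_max.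
have [y y0 hy] := surplus_gt_at0.
(* Half of the gain of [y] over 0: one half is spent on continuity near 0, the other remains as the
   gap to the maximum. *)
set d := (u y - kk y - (u 0 - kk 0)) / 2.
have d0 : 0 < d by rewrite divr_gt0 ?ltr0n // subr_gt0.
have h := half_line_cvg_right surplus_continuous.
have [eta eta0 heta] : exists2 eta : R, 0 < eta &
    forall q, 0 < q <= eta -> u q - kk q < u 0 - kk 0 + d.
  have /cvgr_lt /(_ (u 0 - kk 0 + d)) := h; rewrite ltrDl => /(_ d0).
  rewrite /at_right /within /= => /nbhs_ballP [e /= e0 he].
  exists (e / 2); first by rewrite divr_gt0.
  move=> q /andP[q0 qe]; apply: he => //.
  rewrite /ball /= sub0r normrN gtr0_norm // (le_lt_trans qe) //.
  by rewrite ltr_pdivrMr ?ltr0n // ltr_pMr // ltr1n.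
have k0 := invest_cost_at0.
(* [d] is the surplus forgone at low quality, [kk eta] the investment wasted at high quality. *)
exists c, eta, (Num.min d (kk eta)); split=> //.
- by rewrite lt_min d0 -k0 invest_cost_lt.
- move=> q /andP[q0 qe].
  have hyc := hc y (ltW y0).
  have hq : u q - kk q <= u 0 - kk 0 + d.
    have [<-|qn0] := eqVneq 0 q; first by rewrite lerDl ltW.
    by apply: ltW; apply: heta; rewrite qe andbT lt_neqAle qn0.
  apply: (le_trans hq); rewrite lerBrDr.
  have : Num.min d (kk eta) <= d by rewrite ge_min lexx.
  rewrite /d; lra.
- move=> q q0; split.
    have [<-|qn0] := eqVneq 0 q; first by rewrite k0.
    by rewrite -k0 ltW // invest_cost_lt // lt_neqAle qn0.
  by move=> etaq; rewrite ge_min (ltW (invest_cost_lt (ltW eta0) etaq)) orbT.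
Qed.

End Level0.

(** * Symmetric mechanisms *)

Section AlmostSections.
Local Open Scope classical_set_scope.
Context (R : realType) (n : nat) (P : probability (n.-tuple R) R).
Variable law : set R -> R.
Hypothesis law_ge0 : forall A, 0 <= law A.
Hypothesis indep : forall A : 'I_n -> set R, (forall i, measurable (A i)) ->
  P (box A) = (\prod_(i < n) law (A i))%:E.

(** The preimage of a null set under [mix i] is null for the product measure, so almost all of its
    sections are null. *)
Lemma ae_mix (i : 'I_n) (Q : n.-tuple R -> Prop) : {ae P, forall th, Q th} ->
  {ae P, forall x, {ae P, forall y, Q (mix i (x, y))}}.
Proof.
move=> [N [mN N0 QN]].
pose W := mix i @^-1` N.
have mW : measurable W by rewrite -[X in measurable X]setTI; exact: measurable_mix.
have W0 : (\int[P]_x `|P (xsection W x)| = 0)%E.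
  under eq_integral do rewrite gee0_abs //.
  rewrite -[RHS]N0; symmetry.
  exact: (mix_preserves law_ge0 indep i mN).
have mPW := measurable_fun_xsection P mW.
have /(ae_eq_integral_abs P measurableT mPW) := W0.
apply: filterS => x /(_ I) /= PW; exists (xsection W x); split => //.
  exact: measurable_xsection.
by move=> y /= hy; rewrite /xsection /= inE; apply: QN.
Qed.

End AlmostSections.

Section Surplus.
Local Open Scope classical_set_scope.
Context (R : realType) (E : environment R) (S gamma eta : R).
Hypothesis surplus_le : forall q, 0 <= q -> V E q - CP E q 0 - CI E q 0 <= S.
Hypothesis surplus_le_low : forall q, 0 <= q <= eta ->
  V E q - CP E q 0 - CI E q 0 <= S - gamma.
Hypothesis invest_ge : forall q, 0 <= q ->
  0 <= CI E q 0 /\ (eta < q -> gamma <= CI E q 0).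

(* A winner of low quality forgoes surplus, a loser of high quality wastes its
   investment. *)
Lemma surplus_penalized (A : set R) (x q z cp ci : R) : 0 <= q -> 0 <= z <= 1 ->
  CP E q 0 <= cp -> CI E q 0 <= ci -> (A x <-> q <= eta) ->
  (V E q - cp) * z - ci <= S * z - gamma * loss A x z.
Proof.
move=> q0 /andP[z0 z1] hcp hci hA.
have h1 : (V E q - cp) * z <= (V E q - CP E q 0) * z by rewrite ler_wpM2r // lerB.
have [k0 kg] := invest_ge q0.
have hS := surplus_le q0.
(* Write k for the investment cost at level 0 and w for V minus the production cost there. Then w z
   - k = (w - k) z - k (1 - z). In [A] the first factor is at most [S - gamma] and k >= 0; outside
   [A] it is at most [S] and k >= [gamma]. *)
have [Ax|Ax] := pselect (A x).
  have hSg : V E q - CP E q 0 - CI E q 0 <= S - gamma.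
    by apply: surplus_le_low; rewrite q0 /=; exact/hA.
  rewrite loss_in //; nra.
have {}kg : gamma <= CI E q 0.
  by apply: kg; rewrite ltNge; apply/negP => /hA.
rewrite loss_out //; nra.
Qed.

Section Symmetric.
Context (n : nat) (P : probability (n.-tuple R) R) (a : R).
Variables (M : mechanism R n) (s : strategy M) (i0 : 'I_n).
Hypothesis n2 : (2 <= n)%N.
Hypothesis types : iid_types E P.
Hypothesis dens_cont : {within @unit_itv R, continuous (dens E)}.
Hypothesis gamma0 : 0 <= gamma.
Hypothesis cP_lb : forall q theta, 0 <= q -> 0 <= theta <= 1 -> CP E q 0 <= cP E a q theta.
Hypothesis cI_lb : forall q theta, 0 <= q -> 0 <= theta <= 1 -> CI E q 0 <= cI E a q theta.
Hypothesis feas : feasible E a P s.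
Hypothesis symq : forall i, for_almost_every_type (fun x => quality s i x = quality s i0 x).

(** With firm [i]'s type taken from [x] and its opponents from [y], on-path outcomes become the
    outcomes of a choice of firm [i] against [y], which enter the interim payoff. *)
Lemma messages_mix (i : 'I_n) (x y : n.-tuple R) :
  messages s (mix i (x, y)) = dfwith (messages s y) i (message s i (tnth x i)).
Proof.
apply: functional_extensionality_dep => j; rewrite /messages tnth_mktuple /=.
by case: dfwithP => [|k ik]; rewrite ?eqxx // eq_sym (negPf ik).
Qed.

Lemma qualities_mix (i : 'I_n) (x y : n.-tuple R) :
  qualities s (mix i (x, y)) = dfwith (qualities s y) i (quality s i (tnth x i)).
Proof.
apply: funext => j; rewrite /qualities tnth_mktuple /=.
by case: dfwithP => [|k ik]; rewrite ?eqxx // eq_sym (negPf ik).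
Qed.

Lemma induced_alloc_mix (i : 'I_n) (x y : n.-tuple R) :
  induced_alloc s i (mix i (x, y)) =
  choice_alloc s (message s i (tnth x i)) (quality s i (tnth x i)) y.
Proof. by rewrite /induced_alloc /choice_alloc messages_mix qualities_mix. Qed.

Lemma induced_transfer_mix (i : 'I_n) (x y : n.-tuple R) :
  induced_transfer s i (mix i (x, y)) =
  choice_transfer s (message s i (tnth x i)) (quality s i (tnth x i)) y.
Proof. by rewrite /induced_transfer /choice_transfer messages_mix qualities_mix. Qed.

Let A : set R := [set x | quality s i0 x <= eta].
Let z := induced_alloc s.
Let pen := penalized z A S gamma.
Let net i th := V E (qualities s th i) * induced_alloc s i th - induced_transfer s i th.

Lemma low_quality_measurable : measurable A.
Proof.
case: feas => wp _ _ _.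
have mY : measurable (`]-oo, eta] : set R) by exact: measurable_itv.
have := wp_quality wp i0 measurableT mY.
by rewrite setTI; congr (measurable _).
Qed.

Lemma integrable_net i : P.-integrable setT (EFin \o net i).
Proof.
case: feas => wp _ _ _.
exact: (integrableB measurableT (wp_value wp i) (wp_transfer wp i)).
Qed.

Lemma integrable_pen i : P.-integrable setT (EFin \o pen i).
Proof.
case: feas => wp _ _ al.
apply: integrable_penalized => //; [exact: wp_alloc wp | exact: low_quality_measurable].
Qed.

(** Given firm [i]'s type, the difference splits into a pointwise nonnegative surplus slack and the
    firm's payoff, whose mean is nonnegative by individual rationality. *)
Lemma net_le_penalized i : 0 <= \int[P]_th (pen i th - net i th).
Proof.
case: (feas) => wp bne ir al.
have li := type_law_indep types.
have l0 := type_law_ge0 types.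
have z01 := alloc_ae01 al i.
apply: (integral_ge0_of_sections l0 li (i := i)).
  exact: (integrableB measurableT (integrable_pen i) (integrable_net i)).
have h1 := ae_type types dens_cont i (ir i).
have h2 := ae_type types dens_cont i (symq i).
have h3 := ae_mix l0 li i z01.
apply: filterS3 h1 h2 h3 => x [x01 irx] [_ qx] zx.
set t := tnth x i in x01 irx qx *.
set q := quality s i t in irx *.
have q0 : 0 <= q by exact: wp_quality_ge0 wp i t x01.
pose Z y := choice_alloc s (message s i t) q y.
pose T y := choice_transfer s (message s i t) q y.
have iZ : P.-integrable setT (EFin \o Z) by exact: wp_choice_alloc wp i _ _ q0.
have iT : P.-integrable setT (EFin \o T) by exact: wp_choice_transfer wp i _ _ q0.
(* [F1] is the slack in [surplus_penalized]; [F2] minus the investment cost is the firm's payoff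
   against [y]. *)
pose F1 y := S * Z y - gamma * loss A t (Z y) - (V E q - cP E a q t) * Z y + cI E a q t.
pose F2 y := T y - cP E a q t * Z y.
have mZ : measurable_fun setT Z by apply/measurable_EFinP; exact: measurable_int iZ.
have iF2 : P.-integrable setT (EFin \o F2).
  exact: (integrableB measurableT iT (integrableZl measurableT (cP E a q t) iZ)).
have ic : P.-integrable setT (EFin \o (fun _ : n.-tuple R => cI E a q t)).
  exact: finite_measure_integrable_cst.
have zx' : {ae P, forall y, 0 <= Z y <= 1}.
  by apply: filterS zx => y; rewrite /z induced_alloc_mix.
have il : P.-integrable setT (EFin \o (fun y => loss A t (Z y))).
  apply: (@ae_bounded_integrable _ _ _ _ _ 1) => //.
    apply: measurable_funD; apply: measurable_funM => //; exact: measurable_funB.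
  apply: filterS zx' => y /(loss_ge0 A t) /andP[b0 b1]; by rewrite ger0_norm.
have iF1 : P.-integrable setT (EFin \o F1).
  exact: (integrableD measurableT (integrableB measurableT (integrableB measurableT
    (integrableZl measurableT S iZ) (integrableZl measurableT gamma il))
    (integrableZl measurableT (V E q - cP E a q t) iZ)) ic).
have -> : \int[P]_y (pen i (mix i (x, y)) - net i (mix i (x, y))) =
    \int[P]_y (F1 y + (F2 y - cI E a q t)).
  apply: eq_Rintegral => y _.
  rewrite /pen /net /penalized /z !induced_alloc_mix induced_transfer_mix.
  rewrite qualities_mix tnth_mktuple /= eqxx -/t -/q.
  rewrite dfwithin.
  rewrite -/(Z y) -/(T y) /F1 /F2; ring.
rewrite RintegralD //; last exact: (integrableB measurableT iF2 ic).
apply: addr_ge0.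
  apply: ae_Rintegral_ge0; first by apply/measurable_EFinP; exact: measurable_int iF1.
  apply: filterS zx' => y zy.
  (* [A] is defined through the quality of firm [i0]; symmetry makes it the low-quality set of firm
     [i] at almost every type. *)
  have hA : A t <-> q <= eta by rewrite /A /= -qx.
  have := surplus_penalized q0 zy (cP_lb q0 x01) (cI_lb q0 x01) hA.
  rewrite /F1; lra.
(* What remains is the interim payoff, nonnegative by [irx]. *)
by rewrite RintegralB // Rintegral_probability_cst.
Qed.

Lemma symmetric_buyer_bound : buyer_utility E P s <= S - gamma * 2^-1 ^+ n.
Proof.
case: (feas) => wp _ _ al.
have h : \sum_(i < n) \int[P]_th net i th <= \sum_(i < n) \int[P]_th pen i th.
  apply: ler_sum => i _; rewrite -subr_ge0 -RintegralB //.
  - exact: net_le_penalized.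
  - exact: integrable_pen.
  - exact: integrable_net.
rewrite /buyer_utility Rintegral_ord_sum; last exact: integrable_net.
apply: (le_trans h); rewrite -Rintegral_ord_sum; last exact: integrable_pen.
exact: (penalized_bound (type_law_ge0 types) (type_law_indep types) n2 S
  (wp_alloc wp) al low_quality_measurable gamma0).
Qed.

End Symmetric.
End Surplus.

(** * The symmetric value *)

Section IntegralMonotone.
Local Open Scope classical_set_scope.
Context d (T : measurableType d) (R : realType) (mu : {measure set T -> \bar R}).
Local Open Scope ereal_scope.

(* Both parts of the Lebesgue integral are suprema over simple functions, so
   monotonicity needs no measurability. *)
Lemma le_integral_pointwise (D : set T) (f g : T -> \bar R) :
  (forall x, D x -> f x <= g x) -> \int[mu]_(x in D) f x <= \int[mu]_(x in D) g x.
Proof.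
move=> fg; have fgD x : (f \_ D) x <= (g \_ D) x.
  by rewrite /patch; case: ifPn => //; rewrite inE => /fg.
rewrite /integral; apply: leeB; apply: le_ereal_sup => _ [h /= hh <-]; exists h => //= x.
  by apply: (le_trans (hh x)); rewrite !funeposE; apply: le_max2.
by apply: (le_trans (hh x)); rewrite !funenegE; apply: le_max2 => //; rewrite leeN2.
Qed.

End IntegralMonotone.

Section LowestType.
Local Open Scope classical_set_scope.
Context (R : realType) (n : nat).
Hypothesis n0 : (0 < n)%N.

(** Tied minimizers would each receive a full share; with distinct types the minimizer is unique. *)
Lemma lowest_type_sum (th : n.-tuple R) :
  (forall i j, j != i -> tnth th i <> tnth th j) ->
  \sum_(i < n) lowest_type_wins i th = 1.
Proof.
move=> inj; pose i0 : 'I_n := Ordinal n0.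
case: (@arg_minP _ _ _ i0 xpredT (tnth th) isT) => i _ hi.
rewrite (bigD1 i) //= big1 ?addr0.
  by rewrite /lowest_type_wins (_ : [forall j, _] = true) //; apply/forallP => j; exact: hi.
move=> j ji; rewrite /lowest_type_wins (_ : [forall k, _] = false) //.
apply/negbTE/negP => /forallP /(_ i) h.
by apply: (inj i j ji); apply/eqP; rewrite eq_le h hi.
Qed.

Lemma measurable_lowest_type (i : 'I_n) : measurable_fun setT (@lowest_type_wins R n i).
Proof.
pose B := \bigcap_(j in [set: 'I_n]) [set th : n.-tuple R | tnth th i <= tnth th j].
rewrite (_ : lowest_type_wins i = \1_B).
  apply: measurable_indic; apply: fin_bigcap_measurable => // j _.
  rewrite -[X in measurable X]setTI; apply: measurable_fun_le => //; exact: measurable_tnth.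
apply/funext => th; rewrite /lowest_type_wins indicE; congr ((_ : bool)%:R).
apply/idP/idP => [/forallP h|]; first by rewrite inE => j _ /=; exact: h.
by rewrite inE => h; apply/forallP => j; exact: h.
Qed.

End LowestType.

Section SymmetricValue.
Local Open Scope classical_set_scope.
Context (R : realType) (E : environment R) (S gamma eta : R).
Hypothesis surplus_le : forall q, 0 <= q -> V E q - CP E q 0 - CI E q 0 <= S.
Hypothesis surplus_le_low : forall q, 0 <= q <= eta ->
  V E q - CP E q 0 - CI E q 0 <= S - gamma.
Hypothesis invest_ge : forall q, 0 <= q ->
  0 <= CI E q 0 /\ (eta < q -> gamma <= CI E q 0).
Context (n : nat) (P : probability (n.-tuple R) R) (a : R).
Variable q : R -> R.
Hypothesis n2 : (2 <= n)%N.
Hypothesis types : iid_types E P.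
Hypothesis dens_cont : {within @unit_itv R, continuous (dens E)}.
Hypothesis gamma0 : 0 <= gamma.
Hypothesis vP_lb : forall q theta, 0 <= q -> 0 <= theta <= 1 ->
  CP E q 0 <= virtual E (cP E a) q theta.
Hypothesis vI_lb : forall q theta, 0 <= q -> 0 <= theta <= 1 ->
  CI E q 0 <= virtual E (cI E a) q theta.
Hypothesis mq : measurable_fun (`[0%R, 1%R[ : set R) q.
Hypothesis q0 : forall theta, 0 <= theta < 1 -> 0 <= q theta.

(** Cut down to [0, 1[ because [q] is measurable only there. *)
Let A : set R := `[0%R, 1%R[ `&` [set x | q x <= eta].
Let z := @lowest_type_wins R n.

Lemma lowest_type_ae : {ae P, forall th, (forall i, 0 <= z i th) /\ \sum_(i < n) z i th = 1}.
Proof.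
have li := type_law_indep types.
have l0 := type_law_ge0 types.
(* Indexing by pairs lets one finite intersection of full-measure events rule out all ties. *)
have ties (p : 'I_n * 'I_n) :
    {ae P, forall th, p.2 != p.1 -> tnth th p.1 <> tnth th p.2}.
  have [ji|ji] := boolP (p.2 != p.1); last by apply: aeW.
  have [N [mN N0 DN]] := ties_negligible l0 li (type_law_set1 dens_cont) ji.
  exists N; split=> // th /= h; apply: DN; apply: contrapT => hth; exact: h.
apply: filterS (filter_forall _ ties) => th hth.
split; first by move=> i; rewrite /z /lowest_type_wins ler0n.
by apply: lowest_type_sum; [exact: ltnW|move=> i j; exact: (hth (i, j))].
Qed.

(** Virtual costs also dominate the costs at level 0, so the argument for symmetric mechanisms
    applies with the lowest type as winner. *)
Lemma symmetric_value_bound :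
  (symmetric_value E a P q <= (S - gamma * 2^-1 ^+ n)%:E)%E.
Proof.
have li := type_law_indep types.
have l0 := type_law_ge0 types.
have mA : measurable A.
  have mY : measurable (`]-oo, eta] : set R) by exact: measurable_itv.
  have := mq (measurable_itv _) mY.
  by congr (measurable _); apply/seteqP; split=> x /=; rewrite !in_itv.
pose D : set (n.-tuple R) := [set th : n.-tuple R | forall i, 0 <= tnth th i < 1].
pose G th := \sum_(i < n) penalized z A S gamma i th.
have iG : P.-integrable setT (EFin \o G).
  apply: integrable_ord_sum => i; apply: integrable_penalized => //.
    exact: measurable_lowest_type.
  exact: lowest_type_ae.
apply: (@le_trans _ _ (\int[P]_(th in D) (G th)%:E)%E).
  apply: le_integral_pointwise => th Dth; rewrite lee_fin; apply: ler_sum => i _.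
  have th1 := Dth i; have q0i := q0 th1.
  have th1' : 0 <= tnth th i <= 1 by case/andP: th1 => -> /ltW ->.
  apply: (surplus_penalized surplus_le surplus_le_low invest_ge) => //.
  - by rewrite /z /lowest_type_wins; case: [forall j, _] => /=; rewrite ?lexx ?ler01.
  - exact: vP_lb.
  - exact: vI_lb.
  - by split=> [[]|h] //; split=> //=; rewrite in_itv.
have DE : D = box (fun _ : 'I_n => `[0%R, 1%R[).
  by apply/seteqP; split=> th h i; have := h i; rewrite /= in_itv.
have mD : measurable D by rewrite DE; apply: measurable_box => _; exact: measurable_itv.
(* A profile leaves [D] only if some type equals 1 or lies outside [0, 1], a null event; the
   integral then extends to all profiles. *)
have PD : P (~` D) = 0%E.
  apply/negligibleP; first exact: measurableC.
  have h i : {ae P, forall th, 0 <= tnth th i < 1}.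
    have hx : for_almost_every_type (fun x : R => x != 1).
      exists [set 1]; split=> //; first exact: lebesgue_measure_set1.
      by move=> x /=; apply: contra_notP => /eqP x1 _.
    apply: filterS (ae_type types dens_cont i hx) => th [/andP[t0 t1] tn].
    by rewrite t0 lt_neqAle tn.
  exact: (filter_forall _ h).
rewrite (_ : \int[P]_(th in D) _ = \int[P]_th (G th)%:E)%E.
  rewrite -(fineK (integrable_fin_num measurableT iG)) lee_fin.
  apply: (penalized_bound l0 li n2) => //; last exact: lowest_type_ae.
  exact: measurable_lowest_type.
rewrite [RHS](negligible_integral (measurableC mD) measurableT iG PD).
by rewrite setTD setCK.
Qed.

End SymmetricValue.

(** * Sole sourcing *)

Section SoleSourcing.
Local Open Scope classical_set_scope.
Context (R : realType) (n : nat) (E : environment R) (a : R).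
Context (P : probability (n.-tuple R) R).
Variables (i0 : 'I_n) (c t : R).

(** If firm [i0] departs from quality [c], nobody gets the contract and nothing is paid; shares have
    to add up to 1 on the equilibrium path only. *)
Definition sole_source_mechanism : mechanism R n :=
  @Mechanism R n (fun _ => unit)
    (fun i _ q => ((i == i0) && (q i0 == c))%:R)
    (fun i _ q => t * ((i == i0) && (q i0 == c))%:R).

Definition sole_source_strategy : strategy sole_source_mechanism :=
  @Strategy R n sole_source_mechanism (fun _ _ => tt)
    (fun i _ => if i == i0 then c else 0).

Let s := sole_source_strategy.

Lemma sole_source_choice_alloc i m q th :
  @choice_alloc _ _ _ s i m q th = ((i == i0) && (q == c))%:R.
Proof.
rewrite /choice_alloc /=; case: eqVneq => //= <-.
by rewrite dfwithin.
Qed.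

Lemma sole_source_choice_transfer i m q th :
  @choice_transfer _ _ _ s i m q th = t * ((i == i0) && (q == c))%:R.
Proof.
rewrite /choice_transfer /=; case: eqVneq => //= <-.
by rewrite dfwithin.
Qed.

Lemma sole_source_alloc i th : induced_alloc s i th = (i == i0)%:R.
Proof. by rewrite /induced_alloc /= /qualities /= !eqxx andbT. Qed.

Lemma sole_source_transfer i th : induced_transfer s i th = t * (i == i0)%:R.
Proof. by rewrite /induced_transfer /= /qualities /= !eqxx andbT. Qed.

Lemma sole_source_interim i x m q :
  @interim_payoff _ _ E a P _ s i x m q =
  (t - cP E a q x) * ((i == i0) && (q == c))%:R - cI E a q x.
Proof.
rewrite /interim_payoff; congr (_ - _).
under eq_Rintegral do rewrite sole_source_choice_transfer sole_source_choice_alloc -mulrBl.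
exact: Rintegral_probability_cst.
Qed.

Lemma sole_source_buyer : buyer_utility E P s = V E c - t.
Proof.
rewrite /buyer_utility -[RHS](Rintegral_probability_cst P).
apply: eq_Rintegral => th _.
under eq_bigr do rewrite sole_source_alloc sole_source_transfer.
rewrite (bigD1 i0) //= big1 ?addr0; first by rewrite /qualities /= eqxx !mulr1.
by move=> i /negPf ii0; rewrite ii0 !mulr0 subrr.
Qed.

Hypothesis c0 : 0 <= c.
Hypothesis cost_le : forall x, 0 <= x <= 1 -> cP E a c x + cI E a c x <= t.
Hypothesis cIge0 : forall q x, 0 <= q -> 0 <= x <= 1 -> 0 <= cI E a q x.
Hypothesis cI00 : forall x, 0 < x < 1 -> cI E a 0 x = 0.

(** Cost assumptions such as [cI_at0] speak of interior types; the two endpoints are null. *)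
Lemma for_almost_every_interior (Q : R -> Prop) :
  (forall x, 0 < x < 1 -> Q x) -> for_almost_every_type Q.
Proof.
move=> hQ; exists ([set 0] `|` [set 1]); split.
- by apply: measurableU.
- by apply: null_set_setU => //; exact: lebesgue_measure_set1.
move=> x /=; apply: contra_notP => /not_orP[/eqP x0 /eqP x1] /andP[x0' x1'].
by apply: hQ; rewrite !lt_neqAle eq_sym x0 x0' x1 x1'.
Qed.

Lemma sole_source_equilibrium_payoff i x : 0 < x < 1 ->
  interim_payoff E a P s x (message s i x) (quality s i x) =
  if i == i0 then t - cP E a c x - cI E a c x else 0.
Proof.
move=> x01; rewrite sole_source_interim /=; case: eqVneq => _ /=.
  by rewrite eqxx mulr1.
by rewrite mulr0 cI00 // subr0.
Qed.

Lemma sole_source_equilibrium_ge0 i x : 0 < x < 1 ->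
  0 <= interim_payoff E a P s x (message s i x) (quality s i x).
Proof.
move=> x01; rewrite sole_source_equilibrium_payoff //; case: ifP => // _.
have x01' : 0 <= x <= 1 by case/andP: x01 => /ltW -> /ltW ->.
have := cost_le x01'; lra.
Qed.

(** A choice without the contract yields minus an investment cost, hence at most 0, whereas the
    prescribed choices yield at least 0. *)
Lemma sole_source_feasible : feasible E a P s.
Proof.
have icst (r : R) : P.-integrable setT (fun _ : n.-tuple R => r%:E).
  exact: (finite_measure_integrable_cst P r measurableT).
split.
- split.
  + by move=> i x _ /=; case: ifP.
  + by move=> i; exact: measurable_cst.
  + move=> i; rewrite (_ : induced_alloc s i = cst (i == i0)%:R) //.
    by apply/funext => th; exact: sole_source_alloc.
  + move=> i; under eq_fun do rewrite sole_source_alloc.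
    exact: (icst (V E (if i == i0 then c else 0) * (i == i0)%:R)).
  + move=> i; under eq_fun do rewrite sole_source_transfer.
    exact: icst.
  + move=> i m q _; under eq_fun do rewrite sole_source_choice_alloc.
    exact: icst.
  + move=> i m q _; under eq_fun do rewrite sole_source_choice_transfer.
    exact: icst.
- move=> i; apply: for_almost_every_interior => x x01 m q q0.
  have x01' : 0 <= x <= 1 by case/andP: x01 => /ltW -> /ltW ->.
  have eq0 := sole_source_equilibrium_ge0 i x01.
  rewrite sole_source_interim.
  have [/andP[/eqP ii0 /eqP qc]|_] := boolP ((i == i0) && (q == c)).
    by rewrite sole_source_equilibrium_payoff // ii0 eqxx qc mulr1.
  rewrite mulr0 sub0r (le_trans _ eq0) // oppr_le0; exact: cIge0.
- by move=> i; apply: for_almost_every_interior => x; exact: sole_source_equilibrium_ge0.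
- apply: aeW => th; split; first by move=> i; rewrite sole_source_alloc ler0n.
  under eq_bigr do rewrite sole_source_alloc.
  by rewrite (bigD1 i0) //= big1 ?addr0 ?eqxx // => i /negPf ->.
Qed.

End SoleSourcing.

(** * Small cost levels and the comparison of buyer utilities *)

Section Level.
Local Open Scope classical_set_scope.
Context (R : realType) (E : environment R) (a : R).
Hypothesis a0 : 0 <= a.
Hypothesis lvl : a = 0 \/ type_assumptions E a.

Lemma cP_theta_gt0_or : a = 0 \/ forall q theta : R, 0 < q -> 0 < theta < 1 ->
  0 < dtheta (fun q t => CP E q (a * t)) q theta.
Proof. by case: lvl => [->|t]; [left|right; exact: cP_theta_gt0 t]. Qed.

Lemma cI_theta_gt0_or : a = 0 \/ forall q theta : R, 0 < q -> 0 < theta < 1 ->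
  0 < dtheta (fun q t => CI E q (a * t)) q theta.
Proof. by case: lvl => [->|t]; [left|right; exact: cI_theta_gt0 t]. Qed.

End Level.

Section CostNearZero.
Local Open Scope classical_set_scope.
Context (R : realType) (E : environment R).

(** Continuity of the costs in their second argument at 0. It will be read at [a * theta], which is
    at most [a], so one [d] serves all types when [a < d]. *)
Lemma cost_near_zero (smooth : smooth_environment E) (c e : R) : 0 <= c -> 0 < e ->
  exists2 d : R, 0 < d & forall y, 0 <= y < d ->
    CP E c y + CI E c y <= CP E c 0 + CI E c 0 + e.
Proof.
case: smooth => _ sP sI _ c0 e0.
have c1 (C : R -> R -> R) k : Ck_quadrant k C -> C c y @[y --> 0^'+] --> C c 0.
  move=> hC; apply: half_line_cvg_right; apply: (@Ck_quadrant_comp _ _ _ _ (fun y => (c, y)) hC).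
    move=> x; apply: (@cvg_pair _ _ _ (nbhs x) (nbhs c) (nbhs x) _ _ _ (fun=> c)).
      exact: cvg_cst.
    exact: cvg_id.
  by move=> x; rewrite /half_line /= in_itv /= andbT.
have h : CP E c y + CI E c y @[y --> 0^'+] --> CP E c 0 + CI E c 0.
  by apply: cvgD; [exact: c1 sP|exact: c1 sI].
have /cvgr_lt /(_ (CP E c 0 + CI E c 0 + e)) := h; rewrite ltrDl => /(_ e0).
rewrite /at_right /within /= => /nbhs_ballP [d /= d0 hd].
exists d => // y /andP[y0 yd].
have [<-|yn0] := eqVneq 0 y; first by rewrite lerDl ltW.
apply: ltW; apply: hd; last by rewrite lt_neqAle yn0.
by rewrite /ball /= sub0r normrN ger0_norm.
Qed.

End CostNearZero.

Theorem proposition6 (R : realType) (n : nat) (E : environment R)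
    (P : probability (n.-tuple R) R)
    (n_ge2 : (2 <= n)%N)
    (types : iid_types E P)
    (standing : standing_assumptions E) :
  exists2 abar : R, 0 < abar &
    forall a : R, 0 <= a < abar ->
      (forall (M : mechanism R n) (s : strategy M),
         optimal_symmetric_mechanism E a P s ->
         ~ optimal_mechanism E a P s /\
         exists (M' : mechanism R n) (s' : strategy M'),
           feasible E a P s' /\ buyer_utility E P s < buyer_utility E P s')
      /\
      (forall q_sym : R -> R, is_q_sym n E a q_sym ->
         exists (M' : mechanism R n) (s' : strategy M'),
           feasible E a P s' /\
           (symmetric_value E a P q_sym < (buyer_utility E P s')%:E)%E).
Proof.
case: standing => smooth _ lvl0 near_lvl.
have [c [eta [gamma [c0 gamma0 hS hlow hk]]]] := surplus_gap smooth lvl0.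
set S := V E c - CP E c 0 - CI E c 0 in hS hlow.
(* Half of the guaranteed gap: sole sourcing gives up [eps] and stays strictly above the symmetric
   bound. *)
pose eps := gamma * 2^-1 ^+ n / 2.
have eps0 : 0 < eps.
  by rewrite /eps divr_gt0 // mulr_gt0 // exprn_gt0 // invr_gt0.
have [d d0 hd] := cost_near_zero smooth c0 eps0.
have [e e0 he] : exists2 e : R, 0 < e & forall a, 0 < a < e ->
    level_assumptions E a /\ type_assumptions E a.
  move: near_lvl; rewrite /at_right /within /= => /nbhs_ballP [e /= e0 he].
  exists e => // a /andP[a0 ae]; apply: he => //.
  by rewrite /ball /= sub0r normrN gtr0_norm.
exists (Num.min d e); first by rewrite lt_min d0.
move=> a /andP[a0]; rewrite lt_min => /andP[ad ae].
(* The standing assumptions treat level 0 separately, without derivatives in the type. *)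
have [lvl typ] : level_assumptions E a /\ (a = 0 \/ type_assumptions E a).
  have [a00|an0] := eqVneq 0 a; first by rewrite -a00; split=> //; left.
  have [] : level_assumptions E a /\ type_assumptions E a.
    by apply: he; rewrite ae andbT lt_neqAle an0.
  by move=> l t; split=> //; right.
have [sV sP sI sd] := smooth.
have dens_gt0 := types.1.
have dens_cont : {within @unit_itv R, continuous (dens E)}%classic by case: sd.
have monP := cP_theta_gt0_or typ.
have monI := cI_theta_gt0_or typ.
pose i0 : 'I_n := Ordinal (ltnW n_ge2).
(* The level-0 cost of [c] plus [eps], enough to cover every type at level [a]. *)
pose t := CP E c 0 + CI E c 0 + eps.
have cost_le x : 0 <= x <= 1 -> cP E a c x + cI E a c x <= t.
  move=> /andP[x0 x1]; apply: hd; rewrite mulr_ge0 //=.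
  by apply: le_lt_trans ad; rewrite ler_piMr.
have feas := sole_source_feasible P i0 c0 cost_le (cI_ge0 lvl) (cI_at0 lvl).
have buyer := sole_source_buyer E P i0 c t.
have gain : S - gamma * 2^-1 ^+ n < V E c - t.
  rewrite /S /t; have : eps * 2 = gamma * 2^-1 ^+ n by rewrite /eps divfK.
  move: eps0; lra.
split.
  move=> M s [fs sym _].
  (* The transposition of [i0] and [i], read at [i0], identifies the two quality functions almost
     everywhere. *)
  have symq i : for_almost_every_type (fun x => quality s i x = quality s i0 x).
    by have := (sym (tperm i0 i)).1 i0; rewrite tpermL.
  have bound : buyer_utility E P s <= S - gamma * 2^-1 ^+ n.
    apply: (symmetric_buyer_bound hS hlow hk (i0 := i0) n_ge2 types dens_cont (ltW gamma0) _ _ fs symq).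
    - move=> q x q0 /andP[x0 x1].
      by have := cost_nondecreasing_theta sP a0 monP q0 (lexx 0) x0 x1; rewrite mulr0.
    - move=> q x q0 /andP[x0 x1].
      by have := cost_nondecreasing_theta sI a0 monI q0 (lexx 0) x0 x1; rewrite mulr0.
  have better : buyer_utility E P s < buyer_utility E P (sole_source_strategy i0 c t).
    by rewrite buyer; exact: le_lt_trans gain.
  split; last by exists (sole_source_mechanism i0 c t), (sole_source_strategy i0 c t).
  by case=> _ /(_ _ _ feas); rewrite leNgt better.
(* The virtual surplus at the explicit quality function obeys the same bound, so the same
   sole-sourcing mechanism beats it. *)
move=> q [mq hq].
exists (sole_source_mechanism i0 c t), (sole_source_strategy i0 c t); split=> //.
apply: le_lt_trans (_ : (_ <= (S - gamma * 2^-1 ^+ n)%:E)%E) _.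
  apply: (symmetric_value_bound hS hlow hk n_ge2 types dens_cont (ltW gamma0)) => //.
  - by move=> p x p0 x01; exact: (virtual_cost_lb dens_gt0 sP a0 monP p0 x01).
  - by move=> p x p0 x01; exact: (virtual_cost_lb dens_gt0 sI a0 monI p0 x01).
  - by move=> x /hq [].
by rewrite lte_fin buyer.
Qed.
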